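(* Let $B$ be an invariant polynomial function on $\mathfrak{gl}_n(\mathbb{C})$ of degree at most $n$, and let $Q\in\mathbb{C}[z_1,\ldots,z_n]$ be the unique polynomial that satisfies $B=Q(\sigma_1,\ldots,\sigma_n)$. If $f$ is a transversal holomorphic endomorphism of $\mathbb{P}^n$ of degree $d$, then $$\sum_{f(p)=p}\frac{B(J_f(p))}{\det(I-J_f(p))} = Q\bigl(-d,(-d)^2,\ldots,(-d)^n\bigr),$$ where the sum runs over all fixed points $p\in\mathbb{P}^n$ of $f$.
   Context: $\mathbb{P}^n$ is complex projective space. A holomorphic endomorphism $f:\mathbb{P}^n\to\mathbb{P}^n$ has degree $d$ if it is given by $n+1$ homogeneous polynomials of degree $d$ with no common zero in $\mathbb{C}^{n+1}\setminus\{0\}$. It is transversal if its graph is transversal to the diagonal in $\mathbb{P}^n\times\mathbb{P}^n$; equivalently, all its fixed points are isolated and simple, i.e. $\det(I-J_f(p))\neq 0$ at every fixed point $p$. Here $J_f(p)$ denotes the Jacobian matrix of $f$ at the fixed point $p$ in local coordinates around $p$ (well defined up to conjugation). A polynomial function $B$ on $\mathfrak{gl}_n(\mathbb{C})$ (the $n\times n$ complex matrices) is invariant if $B(gAg^{-1})=B(A)$ for all $g\in \mathrm{GL}_n(\mathbb{C})$ and all $A$; its degree is its degree as a polynomial in the matrix entries. $\sigma_k(A)$ denotes the $k$-th elementary symmetric polynomial of the eigenvalues of $A$, so that $\sigma_k(A)=\operatorname{tr}(\wedge^k A)$. Every invariant polynomial function is uniquely a polynomial in $\sigma_1,\ldots,\sigma_n$.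 *)

(* Defs.v *)
(* The notations of mpoly and of normedtype clash, so normedtype is only
   Required and its canonical structures are imported separately. *)
From mathcomp Require Import all_boot all_order all_algebra.
From mathcomp Require Import complex mpoly.
From mathcomp Require Import boolp classical_sets cardinality fsbigop reals.
From mathcomp Require Import topology derive.
From mathcomp Require normedtype.
Import normed_module.numFieldNormedType.Exports.
Import GRing.Theory.

Set Implicit Arguments.
Unset Strict Implicit.
Unset Printing Implicit Defensive.

Local Open Scope ring_scope.

Section ProjectiveSpace.
Variables (K : fieldType) (n : nat).

(* P^n is the set of lines through 0 in K^(n+1). *)
Definition projspace := {L : {vspace 'rV[K]_n.+1} | \dim L == 1%N}.

Implicit Types (p : projspace) (v : 'rV[K]_n.+1) (i : 'I_n.+1).

Lemma dim_line v : v != 0 -> \dim <[v]>%VS == 1%N.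
Proof. by move=> v0; rewrite dim_vline v0. Qed.

Definition line v (v0 : v != 0) : projspace := exist _ <[v]>%VS (dim_line v0).

(* Homogeneous coordinates of p; they are defined up to a nonzero scalar. *)
Definition hcoord p : 'rV[K]_n.+1 := vpick (val p).

Lemma hcoord_neq0 p : hcoord p != 0.
Proof.
by rewrite /hcoord vpick0; apply: contraTneq (valP p) => ->; rewrite dimv0.
Qed.

(* Affine chart U_i = {x_i <> 0}: affine coordinates are the x_j / x_i, j <> i
   (junk value outside U_i), and [unchart i] is the inverse parametrization
   K^n -> U_i. *)
Definition chart i p : 'rV[K]_n :=
  \row_j (hcoord p 0 (lift i j) / hcoord p 0 i).

Definition dehomog i (z : 'rV[K]_n) : 'rV[K]_n.+1 :=
  \row_k (if unlift i k is Some j then z 0 j else 1).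

Lemma dehomog_neq0 i z : dehomog i z != 0.
Proof.
apply/eqP => /rowP /(_ i); rewrite !mxE unlift_none => /eqP.
by rewrite oner_eq0.
Qed.

Definition unchart i (z : 'rV[K]_n) : projspace := line (dehomog_neq0 i z).

Definition chart_at p : 'I_n.+1 := odflt ord0 [pick i | hcoord p 0 i != 0].

Lemma chart_atP p : hcoord p 0 (chart_at p) != 0.
Proof.
rewrite /chart_at; case: pickP => //= h; have /eqP[] := hcoord_neq0 p.
by apply/rowP => i; rewrite mxE; apply/eqP; have /negbFE := h i.
Qed.

(* Endomorphisms given by n+1 forms F_0, ..., F_n of degree d without common
   zero in K^(n+1) \ {0}: the line through v is sent to the line through F(v). *)
Definition endo_of_degree (d : nat) (f : projspace -> projspace) : Prop :=
  exists F : 'I_n.+1 -> {mpoly K[n.+1]},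
    [/\ forall i, F i \is d.-homog,
        forall v, (forall i, (F i).@[v 0] = 0) -> v = 0
      & forall p v, v \in val p -> (\row_i (F i).@[v 0]) \in val (f p)].

End ProjectiveSpace.

Section Transversality.
Variables (K : numClosedFieldType) (n : nat).
Implicit Types (f : projspace K n -> projspace K n) (p : projspace K n).

(* Complex Jacobian at a fixed point p, in the chart [chart_at p] at both source
   and target; another choice of coordinates conjugates it.  The library's
   Jacobian acts on row vectors, so it is transposed to get the usual matrix
   (d f_j / d z_k)_(j, k). *)
Definition Jac f p : 'M[K]_n :=
  let i := chart_at p in
  (jacobian (fun z : 'rV[K]_n => chart i (f (unchart i z))) (chart i p))^T.

(* The graph of f is transversal to the diagonal: at each of their common points
   (p, p), the tangent space {(u, J u)} of the graph and the tangent space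
   {(u, u)} of the diagonal together span T_p P^n x T_p P^n = K^n x K^n.
   Subspaces are row spaces, whence the transpose. *)
Definition graph_transversal f : Prop :=
  forall p, f p = p ->
    row_full (row_mx 1%:M (Jac f p)^T + row_mx 1%:M 1%:M)%MS.

Lemma graph_transversalP f :
  graph_transversal f <-> forall p, f p = p -> \det (1%:M - Jac f p) != 0.
Proof.
suff E p : row_full (row_mx 1%:M (Jac f p)^T + row_mx 1%:M 1%:M)%MS
           = (\det (1%:M - Jac f p) != 0).
  by split=> h p /h; rewrite E.
set J := Jac f p.
have eqM : (row_mx 1%:M J^T + row_mx 1%:M 1%:M :=: block_mx 1%:M J^T 1%:M 1%:M)%MS.
  by rewrite /block_mx; exact: addsmxE.
rewrite -col_leq_rank eqM col_leq_rank row_full_unit unitmxE unitfE.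
have -> : block_mx 1%:M J^T 1%:M 1%:M
        = block_mx 1%:M J^T 0 1%:M *m block_mx (1%:M - J)^T 0 1%:M 1%:M.
  rewrite mulmx_block !(mul1mx, mulmx1, mul0mx, mulmx0, add0r) linearB /= trmx1.
  by rewrite subrK.
by rewrite det_mulmx det_ublock det_lblock !det1 !mul1r mulr1 det_tr.
Qed.

End Transversality.

Section InvariantPolynomials.
Variables (K : numClosedFieldType) (n : nat).

(* A polynomial in the n^2 entries, as a function on gl_n(K). *)
Definition mxpeval (B : {mpoly K[(n * n)%N]}) (A : 'M[K]_n) : K :=
  B.@[mxvec A 0].

Definition gl_invariant (B : {mpoly K[(n * n)%N]}) : Prop :=
  forall g A : 'M[K]_n, g \in unitmx ->
    mxpeval B (g *m A *m invmx g) = mxpeval B A.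

(* Eigenvalues with algebraic multiplicity: the n roots of char_poly A. *)
Definition eigenvals (A : 'M[K]_n) : seq K :=
  sval (closed_field_poly_normal (char_poly A)).

Definition sigma (k : nat) (A : 'M[K]_n) : K :=
  (mesym n K k).@[fun i : 'I_n => (eigenvals A)`_i].

End InvariantPolynomials.

(* Main.v *)
Require Import Defs.
From HB Require Import structures.
From mathcomp Require Import all_boot all_order all_algebra.
From mathcomp Require Import complex mpoly ring separable cyclotomic.
From mathcomp Require Import boolp classical_sets functions cardinality fsbigop reals.
From mathcomp Require Import topology matrix_normedtype derive.
From mathcomp Require normedtype lebesgue_measure.
Import normed_module.numFieldNormedType.Exports.
Import Order.TTheory GRing.Theory Num.Theory.

Set Implicit Arguments.
Unset Strict Implicit.
Unset Printing Implicit Defensive.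

Local Open Scope ring_scope.

(** The fixed points of f become the zeros of a polynomial system, to which a
    vanishing theorem for sums over zeros applies.

    Let F be the tuple of forms of degree d that defines f, let N = n + 1, and
    let D(v) be the Jacobian matrix of F at v.  Suppose d >= 2.  Every fixed
    line contains exactly d - 1 vectors v <> 0 with F(v) = v; together with 0
    they are the zeros of G(v) = v - F(v), a square system of polynomials of
    degree d whose leading forms have no common zero but 0.  If the zeros of
    such a system are simple, [euler_jacobi] says that the sum over them of
    P(v) / det DG(v) vanishes whenever deg P < N (d - 1).

    By Euler's identity v is an eigenvector of D(v) with eigenvalue d, and D(v)
    induces on K^N / <v> the Jacobian J of f at the fixed point
    ([Jac_quotient]).  So the characteristic polynomial of D(v) is X - d times
    that of J ([char_poly_fixed]).  Hence det DG(v) = (1 - d) det (1 - J), and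
    sigma_k(J) is the value at v of a polynomial of degree at most k (d - 1).
    As Q has weighted degree at most n ([sigma_weight]), B(J) is the value at v
    of a polynomial P of degree at most n (d - 1) < N (d - 1)
    ([sigma_eval_mpoly]).  In the vanishing sum each fixed point contributes
    (d - 1) B(J) / ((1 - d) det (1 - J)) = - B(J) / det (1 - J), and v = 0, where
    D vanishes, contributes Q(-d, ..., (-d)^n).  This is the formula.

    For d = 1 the fixed points are the eigenlines of a matrix with simple
    eigenvalues, and Lagrange interpolation at the eigenvalues replaces
    [euler_jacobi]; for d = 0 there is one fixed point, with J = 0.

    [euler_jacobi] is proved by comparing G with a system of univariate
    polynomials h(x_1), ..., h(x_N), where h has simple roots, among them all
    coordinates of zeros of G.  Since the zeros of G are simple, h(x_k) lies in
    the ideal of G ([simple_zeros_radical]), and since G has no zero at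
    infinity, h(x_k) = sum_j A_kj G_j with deg A_kj <= deg h - d, as soon as
    deg h is large ([generated_controlled]).  The sum for G and P is then the
    sum for (h(x_k))_k and P det A, over a product grid, and there it vanishes
    for degree reasons ([grid_sum_eq0]).  The Nullstellensatz that these steps
    need has a short proof because the field is uncountable. *)

(** * The Nullstellensatz over an uncountable field *)

Definition uncountable (T : Type) := forall f : T -> nat, ~ injective f.

(** A countable set of reals has Lebesgue measure 0, and [0, 1] has measure 1. *)
Lemma uncountable_complex (R : realType) : uncountable R[i].
Proof.
move=> f f_inj.
have cR : countable (@setT R).
  apply/countable_injP; exists (fun x : R => f (x%:C)%C) => x y _ _.
  by move/f_inj => [].
have := @lebesgue_measure.lebesgue_measure_itv R `[0, 1].
have cI := sub_countable (subset_card_le (@subsetT _ _)) cR.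
rewrite (lebesgue_measure.countable_lebesgue_measure0 (cI _)).
rewrite /= constructive_ereal.lte_fin ltr01 -constructive_ereal.EFinD subr0.
by case=> /esym/eqP; rewrite oner_eq0.
Qed.

(** A countable union of finite sets is countable, so one fiber is infinite. *)
Lemma uncountable_fiber (T : choiceType) (f : T -> nat) :
  uncountable T ->
  exists m, forall M, exists a : 'I_M -> T, injective a /\ forall i, f (a i) = m.
Proof.
move=> ucT; apply: contrapT => nf.
have fin m : exists s : seq T, forall a, f a = m -> a \in s.
  have : finite_set [set a | f a = m]%classic.
    apply: contrapT => inf; apply: nf; exists m => M.
    have [X XA leM] := infinite_set_fset M inf.
    have leM' (i : 'I_M) : (i < size (finmap.enum_fset X))%N by apply: leq_trans leM.
    pose x i := tnth (in_tuple (finmap.enum_fset X)) (Ordinal (leM' i)).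
    exists x; split=> [i j|i]; last by apply: XA; rewrite /= mem_tnth.
    rewrite /x !(tnth_nth (x i)) => /eqP.
    by rewrite nth_uniq ?finmap.fset_uniq ?leM' // => /eqP /= ij; apply: val_inj.
  move/finite_seqP => [s es]; exists s => a fa.
  by have : [set a | f a = m]%classic a by []; rewrite es.
have [s sP] := choice fin.
apply: (ucT (fun a => pickle (f a, index a (s (f a))))) => a b.
move/(pcan_inj pickleK) => [fab]; rewrite fab => /(congr1 (nth a (s (f b)))).
by rewrite !nth_index ?sP.
Qed.

Section Nullstellensatz.
Variable N : nat.

Lemma mpoly_dependent (K : fieldType) e M (u : 'I_M -> {mpoly K[N]}) :
  (forall i, msize (u i) <= e)%N -> (#|{: 'X_{1..N < e}}| < M)%N ->
  exists2 c : 'rV[K]_M, c != 0 & \sum_i c 0 i *: u i = 0.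
Proof.
move=> ue ltM.
pose C := \matrix_(i < M, j < #|{: 'X_{1..N < e}}|) (u i)@_(enum_val j).
have : kermx C != 0.
  rewrite kermx_eq0 -row_leq_rank -ltnNge.
  by apply: leq_ltn_trans ltM; apply: rank_leq_col.
case/rowV0Pn => c /sub_kermxP cC c0; exists c => //.
apply/mpolyP => m; rewrite mcoeff0 raddf_sum /=.
case: (ltnP (mdeg m) e) => [lt_me|le_em]; last first.
  rewrite big1 // => i _; rewrite mcoeffZ memN_msupp_eq0 ?mulr0 //.
  by apply: msize_mdeg_ge; apply: leq_trans le_em.
have /rowP/(_ (enum_rank (BMultinom lt_me))) := cC; rewrite !mxE => cC0.
rewrite -[RHS]cC0; apply: eq_bigr => i _.
by rewrite mcoeffZ mxE enum_rankK.
Qed.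

Lemma mpoly_subring_ind (R : comNzRingType) (P : {mpoly R[N]} -> Prop) :
  (forall c, P c%:MP) -> (forall i, P 'X_i) ->
  (forall p q, P p -> P q -> P (p + q)) -> (forall p q, P p -> P q -> P (p * q)) ->
  forall p, P p.
Proof.
move=> PC PX PD PM; apply: mpolyind => [|c m p _ _ Pp]; first exact: (PC 0).
apply: PD => //; rewrite -mul_mpolyC; apply: (PM) => //.
rewrite mpolyXE_id; apply: (big_ind P) => [|p1 p2|i _]; [exact: (PC 1)|exact: PM|].
by elim: (m i) => [|j IHj]; [exact: (PC 1)|rewrite exprS; apply: PM].
Qed.

(** First-order Taylor expansion with polynomial coefficients: b k is a
    difference quotient, whose value at z is a partial derivative. *)
Lemma mpoly_taylor1 (R : comNzRingType) (z : 'I_N -> R) (p : {mpoly R[N]}) :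
  exists2 b : 'I_N -> {mpoly R[N]},
    p = (p.@[z])%:MP + \sum_k b k * ('X_k - (z k)%:MP)
    & forall k, (b k).@[z] = (p^`M(k)).@[z].
Proof.
elim/mpoly_subring_ind: p => [c|i|p q [b pE bz] [b' qE bz']|p q [b pE bz] [b' qE bz']].
- exists (fun=> 0) => [|k]; last by rewrite mderivC.
  by rewrite mevalC big1 ?addr0 // => k _; rewrite mul0r.
- exists (fun k => (i == k)%:R) => [|k].
    rewrite mevalXU (bigD1 i) //= eqxx mul1r big1 ?addr0 1?addrC ?subrK //.
    by move=> k; rewrite eq_sym => /negbTE ->; rewrite mul0r.
  rewrite mderivX mnm1E; case: eqP => [->|_]; last by rewrite scale0r !meval0.
  have -> : (U_(k) - U_(k) = 0 :> 'X_{1..N})%MM by apply/mnmP => j; rewrite mnmBE subnn mnm0E.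
  by rewrite scale1r mpolyX0.
- exists (fun k => b k + b' k) => [|k]; last by rewrite mevalD mderivD mevalD bz bz'.
  under eq_bigr do rewrite mulrDl.
  by rewrite big_split /= {1}pE {1}qE mevalD mpolyCD addrACA.
- exists (fun k => (p.@[z])%:MP * b' k + b k * q) => [|k]; last first.
    rewrite mevalD !mevalM mderivM mevalD !mevalM mevalC bz bz'; ring.
  under eq_bigr do rewrite mulrDl -mulrA [X in _ + X]mulrAC.
  rewrite big_split /= -mulr_sumr -mulr_suml mevalM mpolyCM addrA -mulrDr -qE.
  by rewrite -mulrDl -pE.
Qed.

Definition is_ideal (A : nzRingType) (I : A -> Prop) : Prop :=
  [/\ I 0, forall p q, I p -> I q -> I (p + q) & forall p q, I q -> I (p * q)].

Definition generated (A : nzRingType) r (G : 'I_r -> A) (p : A) : Prop :=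
  exists C : 'I_r -> A, p = \sum_j C j * G j.

Lemma generated_ideal (A : nzRingType) r (G : 'I_r -> A) : is_ideal (generated G).
Proof.
split=> [|_ _ [C ->] [D ->]|p _ [C ->]].
- by exists (fun=> 0); rewrite big1 // => j _; rewrite mul0r.
- by exists (fun j => C j + D j); rewrite -big_split; apply: eq_bigr => j _; rewrite mulrDl.
- by exists (fun j => p * C j); rewrite mulr_sumr; apply: eq_bigr => j _; rewrite mulrA.
Qed.

Lemma generated_gen (A : nzRingType) r (G : 'I_r -> A) j : generated G (G j).
Proof.
exists (fun k => (k == j)%:R); rewrite (bigD1 j) //= eqxx mul1r big1 ?addr0 //.
by move=> k /negbTE ->; rewrite mul0r.
Qed.

Lemma ideal_sum (A : nzRingType) (I : A -> Prop) (T : Type) (s : seq T) (P : pred T) (F : T -> A) :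
  is_ideal I -> (forall i, P i -> I (F i)) -> I (\sum_(i <- s | P i) F i).
Proof. by move=> [I0 ID _] IF; apply: (big_ind I). Qed.

Section Ideals.
Variable A : comNzRingType.

Lemma ideal_sub (I : A -> Prop) p q : is_ideal I -> I p -> I q -> I (p - q).
Proof. by move=> [_ ID IM] Ip Iq; apply: ID => //; rewrite -mulN1r; apply: IM. Qed.

Lemma ideal_mulr (I : A -> Prop) p q : is_ideal I -> I p -> I (p * q).
Proof. by move=> [_ _ IM] Ip; rewrite mulrC; apply: IM. Qed.

Definition adjoin (I : A -> Prop) (x p : A) : Prop := exists u, I (p - u * x).

Lemma adjoin_ideal (I : A -> Prop) x : is_ideal I -> is_ideal (adjoin I x).
Proof.
move=> idI; have [I0 ID IM] := idI; split=> [|p q [u Iu] [v Iv]|p q [u Iu]].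
- by exists 0; rewrite mul0r subr0.
- by exists (u + v); rewrite mulrDl opprD addrACA; apply: ID.
- by exists (p * u); rewrite -mulrA -mulrBr; apply: IM.
Qed.

Lemma adjoin_sub (I : A -> Prop) x p : I p -> adjoin I x p.
Proof. by move=> Ip; exists 0; rewrite mul0r subr0. Qed.

Lemma adjoin_gen (I : A -> Prop) x : is_ideal I -> adjoin I x x.
Proof. by move=> [I0 _ _]; exists 1; rewrite mul1r subrr. Qed.

End Ideals.

Variable K : closedFieldType.
Hypothesis ucK : uncountable K.
Implicit Types (I : {mpoly K[N]} -> Prop) (s p q : {mpoly K[N]}).

(** Equivalently, the localization of K[x]/I at the powers of s is not zero; the
    proof below makes the variables constant in it one after the other. *)
Definition avoids I s := forall m, ~ I (s ^+ m).

(** Otherwise every 'X_k - a becomes invertible once the powers of s are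
    inverted: u_a * ('X_k - a) = s^m modulo I.  Two countability arguments make
    finitely many of the u_a dependent, which clears to s^m * pp('X_k) in I for
    a nonzero univariate pp; splitting pp into linear factors and inverting
    them yields a power of s in I. *)
Lemma avoids_adjoin I s (k : 'I_N) : is_ideal I -> avoids I s ->
  exists a, avoids (adjoin I ('X_k - a%:MP)) s.
Proof.
move=> idI avI; have [I0 ID IM] := idI; apply: contrapT => nav.
have /choice [mu muP] : forall a, exists mu : nat * {mpoly K[N]},
    I (s ^+ mu.1 - mu.2 * ('X_k - a%:MP)).
  move=> a; apply: contrapT => nmu; apply: nav; exists a => m [u Iu].
  by apply: nmu; exists (m, u).
(* uncountably many a, countably many (exponent, degree): some M of the mu a,
   M large, share both, and so are linearly dependent *)
have [M [e [a [a_inj [m [aM ae]]]]]] : exists M e (a : 'I_M -> K), injective a /\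
    exists m, (forall i, (mu (a i)).1 = m) /\
      ((forall i, msize (mu (a i)).2 <= e) /\ #|{: 'X_{1..N < e}}| < M)%N.
  have [m am] := uncountable_fiber (fun a => pickle ((mu a).1, msize (mu a).2)) ucK.
  have [a0 [_ a0m]] := am 1; pose e := msize (mu (a0 ord0)).2.
  have [a [a_inj aE]] := am #|{: 'X_{1..N < e}}|.+1.
  have {}aE i : ((mu (a i)).1, msize (mu (a i)).2) = ((mu (a0 ord0)).1, e).
    by apply: (pcan_inj pickleK); rewrite aE a0m.
  exists _, e, a; split=> //; exists (mu (a0 ord0)).1.
  by split=> [i|]; [case: (aE i)|split=> // i; case: (aE i) => _ ->].
have [c c0 csum] := mpoly_dependent ae.1 ae.2.
pose pp : {poly K} := \sum_i c 0 i *: \prod_(j | j != i) ('X - (a j)%:P).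
have pp0 : pp != 0.
  have /existsP[i ci] : [exists i, c 0 i != 0].
    apply: contraNT c0; rewrite negb_exists => /forallP c0.
    by apply/eqP/rowP => i; rewrite mxE; apply/eqP; have := c0 i; rewrite negbK.
  apply: contraNneq ci => /(congr1 (horner^~ (a i))).
  rewrite horner0 horner_sum (bigD1 i) //= [X in _ + X]big1 ?addr0; last first.
    move=> j ji; rewrite hornerZ horner_prod (bigD1 i) 1?eq_sym //=.
    by rewrite hornerXsubC subrr mul0r mulr0.
  rewrite hornerZ horner_prod => /eqP; rewrite mulf_eq0 => /orP[//|].
  move=> /prodf_eq0 [j ji]; rewrite hornerXsubC subr_eq0 => /eqP/a_inj ij.
  by rewrite ij eqxx in ji.
have Ipp : I (s ^+ m * horner_alg ('X_k) pp).
  have -> : s ^+ m * horner_alg 'X_k pp =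
    \sum_i (c 0 i *: \prod_(j | j != i) ('X_k - (a j)%:MP)) *
         (s ^+ m - (mu (a i)).2 * ('X_k - (a i)%:MP)).
    rewrite rmorph_sum mulr_sumr /=.
    under [RHS]eq_bigr do rewrite mulrBr.
    rewrite sumrB [X in _ = _ - X](_ : _ = 0) ?subr0.
      apply: eq_bigr => i _; rewrite mulrC linearZ /= rmorph_prod /=.
      rewrite mulr_algl; congr (_ *: _ * _); apply: eq_bigr => j _.
      by rewrite rmorphB /= horner_algX horner_algC alg_mpolyC.
    transitivity ((\sum_i c 0 i *: (mu (a i)).2) * \prod_j ('X_k - (a j)%:MP));
      last by rewrite csum mul0r.
    rewrite mulr_suml; apply: eq_bigr => i _.
    rewrite [in RHS](bigD1 i) //= -!scalerAl; congr (_ *: _).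
    by rewrite mulrC [LHS]mulrAC mulrA mulrAC -mulrA.
  by apply: ideal_sum => // i _; rewrite -(aM i); apply: IM.
(* modulo I, each factor 'X_k - z of pp('X_k) divides a power of s *)
have [r ppE] := closed_field_poly_normal pp.
have Ir : exists m', I (s ^+ m' * \prod_(z <- r) ('X_k - z%:MP)).
  exists m; move: Ipp; rewrite ppE linearZ /= rmorph_prod /=.
  under eq_bigr do rewrite rmorphB /= horner_algX horner_algC alg_mpolyC.
  rewrite mulr_algl => /(IM (lead_coef pp)^-1%:MP).
  rewrite mul_mpolyC -scalerAr scalerA.
  by rewrite mulVf ?scale1r // lead_coef_eq0.
elim: r {ppE} Ir => [|z r IHr] [m']; first by rewrite big_nil mulr1; apply: avI.
rewrite big_cons => Im'; apply: IHr; exists ((mu z).1 + m')%N.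
rewrite exprD.
have -> : s ^+ (mu z).1 * s ^+ m' * \prod_(j <- r) ('X_k - j%:MP) =
  s ^+ m' * \prod_(j <- r) ('X_k - j%:MP) * (s ^+ (mu z).1 - (mu z).2 * ('X_k - z%:MP))
  + (mu z).2 * (s ^+ m' * (('X_k - z%:MP) * \prod_(j <- r) ('X_k - j%:MP))).
  by ring.
by apply: ID; apply: IM.
Qed.

Lemma avoids_point I s (ks : seq 'I_N) : is_ideal I -> avoids I s ->
  exists (J : {mpoly K[N]} -> Prop) (z : 'I_N -> K),
    [/\ is_ideal J, forall p, I p -> J p, avoids J s
      & forall k, k \in ks -> J ('X_k - (z k)%:MP)].
Proof.
move=> idI avI; elim: ks => [|k ks [J [z [idJ IJ avJ zJ]]]].
  by exists I, (fun=> 0).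
have [a av] := avoids_adjoin k idJ avJ.
exists (adjoin J ('X_k - a%:MP)), (fun i => if i == k then a else z i); split=> //.
- exact: adjoin_ideal.
- by move=> p /IJ; apply: adjoin_sub.
- move=> i; rewrite inE; case: eqP => [-> _|_ /= iks]; first exact: adjoin_gen.
  by apply: adjoin_sub; apply: zJ.
Qed.

(** Adjoining 'X_k - z_k for every k while avoiding the powers of s leaves an
    ideal modulo which every polynomial is its value at z. *)
Theorem nullstellensatz I s : is_ideal I ->
  (forall z, (forall p, I p -> p.@[z] = 0) -> s.@[z] = 0) ->
  exists m, I (s ^+ m).
Proof.
move=> idI sI; apply: contrapT => nI.
have avI : avoids I s by move=> m Im; apply: nI; exists m.
have [J [z [idJ IJ avJ zJ]]] := avoids_point (enum 'I_N) idI avI.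
have [J0 JD JM] := idJ.
have modJ p : J (p - (p.@[z])%:MP).
  have [b pE _] := mpoly_taylor1 z p; rewrite {1}pE [_ + \sum_k _]addrC addrK.
  by apply: ideal_sum => // k _; apply: JM; apply: zJ; rewrite mem_enum.
have Iz p : I p -> p.@[z] = 0.
  move=> /IJ Jp; apply/eqP; apply: contrapT => pz; apply: (avJ 0).
  have Jpz : J (p.@[z])%:MP by rewrite -[X in J X](subKr p); apply: ideal_sub.
  move/(JM (p.@[z])^-1%:MP): Jpz; rewrite -mpolyCM mulVf //; exact/negP.
apply: (avJ 1); rewrite expr1.
by have := modJ s; rewrite (sI z Iz) subr0.
Qed.

End Nullstellensatz.

(** * Degree bounds *)

Section DegreeBounds.
Variables (N : nat) (K : idomainType).
Implicit Types p q : {mpoly K[N]}.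

Lemma msize_leP p e : reflect (forall m, m \in msupp p -> mdeg m < e)%N (msize p <= e)%N.
Proof.
apply: (iffP idP) => [le_pe m /msize_mdeg_lt lt_m|lt_e].
  exact: leq_trans le_pe.
by rewrite msizeE; apply/bigmax_leqP_seq => m /lt_e.
Qed.

Lemma msize_sum_le (J : Type) (s : seq J) (P : pred J) (F : J -> {mpoly K[N]}) e :
  (forall j, P j -> msize (F j) <= e)%N -> (msize (\sum_(j <- s | P j) F j) <= e)%N.
Proof.
move=> Fe; apply: (big_ind (fun p => msize p <= e)%N) => //; first by rewrite msize0.
by move=> p q pe qe; apply: leq_trans (msizeD_le _ _) _; rewrite geq_max pe.
Qed.

Lemma msizeM_leS p q a b :
  (msize p <= a.+1 -> msize q <= b.+1 -> msize (p * q) <= (a + b).+1)%N.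
Proof.
have [->|p0] := eqVneq p 0; first by rewrite mul0r msize0.
have [->|q0] := eqVneq q 0; first by rewrite mulr0 msize0.
rewrite msizeM // => pa qb; apply: leq_trans (_ : _ <= (a.+1 + b.+1).-1)%N _.
  by rewrite -!subn1 leq_sub2r // leq_add.
by rewrite addSn addnS.
Qed.

Lemma msizeB_le p q e : (msize p <= e -> msize q <= e -> msize (p - q) <= e)%N.
Proof.
by move=> pe qe; apply: leq_trans (msizeD_le _ _) _; rewrite msizeN geq_max pe.
Qed.

Lemma dhomog_msize_le p e : p \is e.-homog -> (msize p <= e.+1)%N.
Proof. by move=> /dhomogP pe; apply/msize_leP => m /pe ->. Qed.

End DegreeBounds.

(** P e x reads: x has degree at most e, for some filtration of R compatible
    with the ring operations. *)
Section Graded.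
Variables (R : comNzRingType) (P : nat -> R -> Prop).
Hypotheses (P0 : forall e, P e 0) (P1 : P 0 1) (PN : forall e x, P e x -> P e (- x)).
Hypothesis PD : forall e x y, P e x -> P e y -> P e (x + y).
Hypothesis PM : forall e f x y, P e x -> P f y -> P (e + f)%N (x * y).

Lemma graded_prod n (F : 'I_n -> R) e :
  (forall i, P e (F i)) -> P (n * e)%N (\prod_i F i).
Proof.
elim: n F => [|n IHn] F PF; first by rewrite big_ord0.
by rewrite big_ord_recl mulSn; apply: PM; [exact: PF|apply: IHn].
Qed.

Lemma graded_det n (M : 'M[R]_n) e :
  (forall i j, P e (M i j)) -> P (n * e)%N (\det M).
Proof.
move=> PMij; apply: (big_ind (P (n * e)%N)) => [//|x y|s _]; first exact: PD.
rewrite mulr_sign; have Ps : P (n * e)%N (\prod_i M i (perm.fun_of_perm s i)).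
  exact: graded_prod.
by case: ifP => // _; apply: PN.
Qed.

End Graded.

(** * Ideals of systems with simple zeros or without zero at infinity *)

Section Elimination.
Variables (N : nat) (K : closedFieldType).
Hypothesis ucK : uncountable K.
Implicit Types (z : 'I_N -> K) (p q h : {mpoly K[N]}).

Definition jacobian_at (G : 'I_N -> {mpoly K[N]}) z : 'M[K]_N :=
  \matrix_(j, k) ((G j)^`M(k)).@[z].

(** At a zero z of G, write G = b (x - z).  Then \det b * (x_k - z_k) is in the
    ideal (G) for all k, so \det b * q is too when q(z) = 0; and \det b does not
    vanish at z.  Hence the ideal (G) : q has no zero, and it contains 1. *)
Lemma simple_zeros_radical (G : 'I_N -> {mpoly K[N]}) q :
  (forall z, (forall j, (G j).@[z] = 0) -> \det (jacobian_at G z) != 0) ->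
  (forall z, (forall j, (G j).@[z] = 0) -> q.@[z] = 0) ->
  generated G q.
Proof.
move=> simG qG; have idG := generated_ideal G; have [I0 ID IM] := idG.
pose J p := generated G (p * q).
have idJ : is_ideal J.
  split=> [|p1 p2|p1 p2]; rewrite /J ?mul0r ?mulrDl -?mulrA //; first exact: ID.
  exact: IM.
suff : exists m, J (1 ^+ m) by case=> m; rewrite expr1n /J mul1r.
apply: nullstellensatz => // z Jz.
have Gz j : (G j).@[z] = 0.
  by apply: Jz; rewrite /J; apply: (ideal_mulr q idG); apply: generated_gen.
have /choice [b bP] : forall j, exists b : 'I_N -> {mpoly K[N]},
    G j = \sum_k b k * ('X_k - (z k)%:MP)
    /\ forall k, (b k).@[z] = ((G j)^`M(k)).@[z].
  move=> j; have [b Gj bz] := mpoly_taylor1 z (G j).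
  by exists b; split; rewrite // {1}Gj Gz add0r.
have [b' qE _] := mpoly_taylor1 z q; rewrite qG // mpolyC0 add0r in qE.
(* G = bM (x - z), so Cramer's rule puts \det bM * (x - z) in the ideal of G *)
pose bM := \matrix_(j, k) b j k.
have bMdet : (\det bM).@[z] = 0.
  apply: Jz; rewrite /J [X in _ * X]qE mulr_sumr; apply: ideal_sum => // k _.
  rewrite mulrCA; apply: (IM).
  pose x := \col_k ('X_k - (z k)%:MP) : 'cV[{mpoly K[N]}]_N.
  have bx : bM *m x = \col_j G j.
    apply/colP => j; rewrite !mxE (bP j).1; apply: eq_bigr => i _.
    by rewrite !mxE.
  have : (\adj bM *m (bM *m x)) k 0 = \det bM * ('X_k - (z k)%:MP).
    by rewrite mulmxA mul_adj_mx mul_scalar_mx !mxE.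
  rewrite bx => <-; exists (fun j => \adj bM k j); rewrite [LHS]mxE.
  by apply: eq_bigr => j _; congr (_ * _); rewrite mxE.
have /negP[] := simG z Gz; apply/eqP; rewrite -[RHS]bMdet.
rewrite -(det_map_mx (meval z)); congr (\det _).
by apply/matrixP => j k; rewrite mxE -(bP j).2 !mxE.
Qed.

Section Forms.
Variables (d : nat) (F : 'I_N -> {mpoly K[N]}).
Hypothesis F_homog : forall j, F j \is d.-homog.
Hypothesis F_zero : forall z, (forall j, (F j).@[z] = 0) -> forall k, z k = 0.

(** A power 'X_k^m of each variable is in the ideal, hence so is any monomial of
    degree larger than N m, which is divisible by one of them. *)
Lemma forms_generate_high_degree :
  exists M0, forall p, (forall m, m \in msupp p -> M0 <= mdeg m)%N -> generated F p.
Proof.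
have idF := generated_ideal F; have [I0 ID IM] := idF.
have /choice [mu muP] : forall k, exists m, generated F ('X_k ^+ m).
  move=> k; apply: nullstellensatz => // z Fz.
  by rewrite mevalXU; apply: F_zero => j; apply: Fz; apply: generated_gen.
pose m := \max_k mu k.
exists (N * m).+1 => p ple.
rewrite [p]mpolyE big_seq; apply: ideal_sum => // a /ple lt_a.
rewrite -mul_mpolyC; apply: (IM).
have /existsP[k le_ma] : [exists k, m <= a k]%N.
  apply: contraLR lt_a; rewrite negb_exists => /forallP lt_am.
  rewrite -leqNgt mdegE -[N in (N * _)%N]card_ord -sum_nat_const.
  by apply: leq_sum => k _; apply: ltnW; rewrite ltnNge.
have -> : a = (a - U_(k) *+ mu k + U_(k) *+ mu k)%MM.
  rewrite submK //; apply/mnm_lepP => i; rewrite mulmnE mnm1E.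
  case: eqP => [<-|_]; rewrite ?mul1n //.
  exact: leq_trans (leq_bigmax k) le_ma.
by rewrite mpolyXD -mpolyXn; apply: IM.
Qed.

Lemma pihomogM_homog e p j :
  pihomog mdeg (e + d) (p * F j) = pihomog mdeg e p * F j.
Proof.
rewrite {1}(pihomog_partitionE (leq_maxl (msize p) e.+1)) mulr_suml raddf_sum /=.
have lt_e : (e < maxn (msize p) e.+1)%N by rewrite leq_max leqnn orbT.
have hom i : pihomog mdeg i p * F j \is (i + d).-homog.
  by rewrite dhomogM // pihomogP.
rewrite (bigD1 (Ordinal lt_e)) //= pihomog_dE // big1 ?addr0 // => i ie.
apply: pihomog_ne0 (hom i); apply: contraNneq ie => /eqP.
by rewrite eqn_add2r => /eqP ie; apply/eqP/val_inj.
Qed.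

Lemma forms_generate_homog :
  exists M0, (d <= M0)%N /\ forall e p, (M0 <= e)%N -> p \is e.-homog ->
    exists2 C, (forall j, C j \is (e - d).-homog) & p = \sum_j C j * F j.
Proof.
have [M0 M0P] := forms_generate_high_degree.
exists (maxn d M0); split=> [|e p]; first exact: leq_maxl.
rewrite geq_max => /andP[de M0e] pe; have [|C pE] := M0P p.
  by move=> m; move/dhomogP: pe => pe /pe ->.
exists (fun j => pihomog mdeg (e - d) (C j)); first by move=> j; apply: pihomogP.
rewrite -[LHS](pihomog_dE pe) {1}pE raddf_sum /=; apply: eq_bigr => j _.
by rewrite -pihomogM_homog subnK.
Qed.

End Forms.
End Elimination.

(** A finite family of maximal rank in W spans W; this is how bounds that hold
    for each element of a subspace are made uniform below. *)
Lemma maximal_rank_family (K : fieldType) L (W : 'rV[K]_L -> Prop) :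
  exists k (M : 'M[K]_(k, L)),
    (forall i, W (row i M)) /\ forall w, W w -> (w <= M)%MS.
Proof.
pose P r := exists k (M : 'M[K]_(k, L)), (forall i, W (row i M)) /\ \rank M = r.
have exP : exists r, `[< P r >].
  by exists 0%N; apply/asboolP; exists 0%N, 0; split; [case|rewrite mxrank0].
have ubP r : `[< P r >] -> (r <= L)%N.
  by move=> /asboolP[k [M [_ <-]]]; apply: rank_leq_col.
case: (ex_maxnP exP ubP) => r /asboolP[k [M [WM rkM]]] maxr.
exists k, M; split=> // w Ww.
have sub : (M <= col_mx M w)%MS by rewrite -addsmxE addsmxSl.
apply: submx_trans (_ : (w <= col_mx M w)%MS) _; first by rewrite -addsmxE addsmxSr.
rewrite -(geq_leqif (mxrank_leqif_sup sub)) rkM; apply: maxr; apply/asboolP.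
exists (k + 1)%N, (col_mx M w); split=> // i.
case: (splitP i) => j ij.
  by rewrite (_ : i = lshift 1 j) ?rowKu //; apply: val_inj.
by rewrite (_ : i = rshift k j) ?rowKd ?row_id //; apply: val_inj.
Qed.

(** F is the tuple of leading forms of G; that they have no common zero but 0
    means that G has no zero at infinity. *)
Section CompleteIntersection.
Variables (N d : nat) (K : closedFieldType).
Hypothesis ucK : uncountable K.
Variables F G : 'I_N -> {mpoly K[N]}.
Hypothesis F_homog : forall j, F j \is d.+1.-homog.
Hypothesis F_zero : forall z, (forall j, (F j).@[z] = 0) -> forall k, z k = 0.
Hypothesis G_top : forall j, (msize (F j - G j) <= d.+1)%N.
Implicit Types (z : 'I_N -> K) (p q h : {mpoly K[N]}).

(** A combination of the G j in which no cancellation of degrees occurs: each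
    product C j * G j has size at most e. *)
Definition controlled e p : Prop :=
  exists2 C : 'I_N -> {mpoly K[N]},
    (forall j, msize (C j) + d.+1 <= e)%N & p = \sum_j C j * G j.

Lemma controlled_generated e p : controlled e p -> generated G p.
Proof. by case=> C _ ->; exists C. Qed.

Lemma controlled_le e e' p : (e <= e')%N -> controlled e p -> controlled e' p.
Proof. by move=> ee [C Ce ->]; exists C => // j; apply: leq_trans ee. Qed.

Lemma controlled0 e : (d.+1 <= e)%N -> controlled e 0.
Proof.
move=> de; exists (fun=> 0) => [j|]; first by rewrite msize0.
by rewrite big1 // => j _; rewrite mul0r.
Qed.

Lemma controlledD e p q : controlled e p -> controlled e q -> controlled e (p + q).
Proof.
move=> [C Ce ->] [D De ->]; exists (fun j => C j + D j) => [j|].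
  apply: leq_trans (leq_add (msizeD_le _ _) (leqnn _)) _.
  by rewrite addn_maxl geq_max Ce De.
by rewrite -big_split; apply: eq_bigr => j _; rewrite mulrDl.
Qed.

Lemma controlledZ e (c : K) p : controlled e p -> controlled e (c *: p).
Proof.
move=> [C Ce ->]; exists (fun j => c *: C j) => [j|].
  by apply: leq_trans (leq_add (msizeZ_le _ _) (leqnn _)) (Ce j).
by rewrite scaler_sumr; apply: eq_bigr => j _; rewrite scalerAl.
Qed.

(** The leading form of h is a combination of the F j when its degree is large;
    subtracting the same combination of the G j lowers the degree. *)
Lemma reduce_degree :
  exists M0, (d.+1 <= M0)%N /\ forall e h, (M0 <= e)%N -> (msize h <= e)%N ->
    exists2 r, (msize r <= M0)%N & controlled e (h - r).
Proof.
have [M0 [dM0 M0P]] := forms_generate_homog ucK F_homog F_zero.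
exists M0; split=> // e h /subnKC <-; elim: (e - M0)%N h => {e} [|e IHe] h hle.
  rewrite addn0 in hle *; exists h => //; rewrite subrr; exact: controlled0.
rewrite addnS in hle; set e0 := (M0 + e)%N in hle IHe *.
have M0e : (M0 <= e0)%N by rewrite leq_addr.
have [C Ce tE] := M0P e0 (pihomog mdeg e0 h) M0e (pihomogP mdeg e0 h).
have lowh : (msize (h - pihomog mdeg e0 h) <= e0)%N.
  rewrite {1}(pihomog_partitionE hle) big_ord_recr /= addrK.
  apply: msize_sum_le => i _; apply: leq_trans (ltn_ord i).
  by apply: dhomog_msize_le; apply: pihomogP.
have [|r rM0 [D De DE]] := IHe (h - \sum_j C j * G j).
  have -> : h - \sum_j C j * G j =
      (h - pihomog mdeg e0 h) + \sum_j C j * (F j - G j).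
    under [in RHS]eq_bigr do rewrite mulrBr.
    by rewrite sumrB -tE addrA subrK.
  apply: leq_trans (msizeD_le _ _) _; rewrite geq_max lowh /=.
  apply: msize_sum_le => j _; apply: leq_trans (msizeM_leS (dhomog_msize_le (Ce j)) (G_top j)) _.
  by rewrite -addnS subnK // (leq_trans dM0).
exists r => //; rewrite addnS; have -> : h - r = \sum_j C j * G j + (h - \sum_j C j * G j - r).
  by rewrite addrA [X in _ = X - _]addrC subrK.
apply: controlledD; last by apply: (@controlled_le e0) => //; exists D.
exists C => // j; apply: leq_trans (leq_add (dhomog_msize_le (Ce j)) (leqnn _)) _.
by rewrite addSn subnK // (leq_trans dM0).
Qed.

(** After reduction only the elements of (G) of size at most M0 matter.  They
    form a finite-dimensional space, so one bound serves for all of them. *)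
Lemma generated_controlled :
  exists M1, (d.+1 <= M1)%N /\ forall e h, (M1 <= e)%N -> (msize h <= e)%N -> generated G h ->
    controlled e h.
Proof.
have idG := generated_ideal G; have [I0 ID IM] := idG.
have [M0 [dM0 M0P]] := reduce_degree.
pose T := {: 'X_{1..N < M0}}.
pose pol (w : 'rV[K]_#|T|) : {mpoly K[N]} := \sum_j w 0 j *: 'X_[enum_val j : 'X_{1..N < M0}].
have polK h : (msize h <= M0)%N -> exists w, h = pol w.
  move=> hM0; exists (\row_j h@_(enum_val j : 'X_{1..N < M0})).
  rewrite [LHS](mpolywE hM0) /pol (reindex (enum_val : 'I_#|T| -> 'X_{1..N < M0})) /=; last first.
    by apply: onW_bij; apply: enum_val_bij.
  by apply: eq_bigr => j _; rewrite mxE.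
have [k [M [WM maxM]]] := maximal_rank_family (fun w => generated G (pol w)).
have /choice [E EP] : forall i, exists e, controlled e (pol (row i M)).
  move=> i; have [C CE] := WM i.
  exists ((\max_j msize (C j)) + d.+1)%N; exists C => // j.
  by rewrite leq_add2r (leq_bigmax j).
exists (maxn M0 (\max_i E i)); split=> [|e h]; first by rewrite leq_max dM0.
rewrite geq_max => /andP[M0e Ee] he Gh.
have [r rM0 hr] := M0P e h M0e he.
rewrite -(subrK r h); apply: controlledD => //.
have [w rw] := polK r rM0.
have /submxP [c wE] : (w <= M)%MS.
  by apply: maxM; rewrite -rw -(subKr h r); apply: ideal_sub => //; apply: controlled_generated hr.
have -> : r = \sum_i c 0 i *: pol (row i M).
  rewrite rw wE /pol; under [in RHS]eq_bigr do rewrite scaler_sumr.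
  rewrite exchange_big /=; apply: eq_bigr => j _; rewrite mxE scaler_suml.
  by apply: eq_bigr => i _; rewrite mxE scalerA.
apply: (big_ind (controlled e)) => [|p q|i _]; [|exact: controlledD|].
  by apply: controlled0; apply: leq_trans M0e.
apply: controlledZ; apply: controlled_le (EP i).
by apply: leq_trans Ee; rewrite (leq_bigmax i).
Qed.

(** The powers of 'X_k reduce modulo (G) to a finite-dimensional space, hence a
    nonzero univariate polynomial in 'X_k is in (G). *)
Lemma finite_zero_coordinates :
  exists s : seq K, forall z, (forall j, (G j).@[z] = 0) -> forall k, z k \in s.
Proof.
have idG := generated_ideal G; have [I0 ID IM] := idG.
have [M0 [dM0 M0P]] := reduce_degree.
have red h : exists2 r, (msize r <= M0)%N & generated G (h - r).
  have [r rM0 /controlled_generated hr] := M0P _ h (leq_maxl _ _) (leq_maxr M0 (msize h)).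
  by exists r.
suff /choice [s sP] : forall k, exists s : seq K,
    forall z, (forall j, (G j).@[z] = 0) -> z k \in s.
  exists (flatten [seq s k | k <- enum 'I_N]) => z Gz k.
  by apply/flatten_mapP; exists k; rewrite ?mem_enum ?sP.
move=> k; pose M := #|{: 'X_{1..N < M0}}|.+1.
have /choice [r rP] : forall i : 'I_M, exists r,
    (msize r <= M0)%N /\ generated G ('X_k ^+ i - r).
  by move=> i; have [r] := red ('X_k ^+ i); exists r.
have [c c0 cr] := mpoly_dependent (fun i => (rP i).1) (ltnSn _).
pose g : {poly K} := \sum_(i < M) c 0 i *: 'X^i.
have g0 : g != 0.
  apply: contraNneq c0 => /polyP g0; apply/eqP/rowP => i.
  have := g0 i; rewrite mxE coef0 coef_sum (bigD1 i) //= big1 => [|j ji].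
    by rewrite addr0 coefZ coefXn eqxx mulr1.
  by rewrite coefZ coefXn (inj_eq val_inj) eq_sym (negbTE ji) mulr0.
have [s gE] := closed_field_poly_normal g; exists s => z Gz.
have : root g (z k).
  have : generated G (\sum_i c 0 i *: 'X_k ^+ i).
    have -> : \sum_i c 0 i *: 'X_k ^+ i = \sum_i c 0 i *: ('X_k ^+ i - r i).
      by under [RHS]eq_bigr do rewrite scalerBr; rewrite sumrB cr subr0.
    apply: ideal_sum => // i _.
    by rewrite -mul_mpolyC; apply: IM; have [] := rP i.
  case=> C CE; apply/rootP; rewrite horner_sum.
  transitivity (\sum_i c 0 i *: 'X_k ^+ i).@[z].
    rewrite raddf_sum; apply: eq_bigr => i _.
    by rewrite hornerZ hornerXn /= mevalZ rmorphXn /= mevalXU.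
  by rewrite CE raddf_sum big1 // => j _; rewrite /= mevalM Gz mulr0.
by rewrite gE rootZ ?lead_coef_eq0 // root_prod_XsubC.
Qed.

End CompleteIntersection.

(** * Lagrange interpolation on a grid *)

Section Lagrange.
Variables (K : fieldType) (m : nat) (a : 'I_m -> K).
Hypothesis a_inj : injective a.

(** The derivative at a j of the product of the 'X - a l. *)
Definition node_weight j : K := \prod_(l | l != j) (a j - a l).

Lemma node_weight_neq0 j : node_weight j != 0.
Proof.
by apply/prodf_neq0 => l lj; rewrite subr_eq0 (inj_eq a_inj) eq_sym.
Qed.

(** Comparison of top coefficients in the Lagrange interpolation formula; it is
    the residue theorem on the projective line. *)
Lemma lagrange_top_coef (p : {poly K}) : (size p <= m)%N ->
  \sum_j p.[a j] / node_weight j = p`_m.-1.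
Proof.
move=> sz_p.
pose L j : {poly K} := \prod_(l | l != j) ('X - (a l)%:P).
have szL j : size (L j) = m.
  rewrite /L -big_filter size_prod_XsubC size_filter.
  rewrite -[RHS](card_ord m) cardT enumT -(count_predC (pred1 j)).
  by rewrite (count_uniq_mem _ (index_enum_uniq _)) mem_index_enum.
have L_top j : (L j)`_m.-1 = 1.
  have /monicP := monic_prod_XsubC (index_enum 'I_m) (fun l => l != j) a.
  by rewrite lead_coefE -/(L j) szL.
have L_node i j : (L j).[a i] = (i == j)%:R * node_weight j.
  rewrite horner_prod; case: eqP => [->|/eqP ij].
    by rewrite mul1r; apply: eq_bigr => l _; rewrite hornerXsubC.
  by rewrite mul0r (bigD1 i) //= hornerXsubC subrr mul0r.
have pE : p = \sum_j (p.[a j] / node_weight j) *: L j.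
  apply/eqP; rewrite -subr_eq0; apply/eqP.
  apply: (@roots_geq_poly_eq0 _ _ [seq a i | i <- enum 'I_m]).
  - apply/allP => _ /mapP[i _ ->]; apply/rootP; rewrite hornerD hornerN horner_sum.
    rewrite (bigD1 i) //= hornerZ L_node eqxx mul1r divfK ?node_weight_neq0 //.
    rewrite big1 ?addr0 ?subrr // => j ji.
    by rewrite hornerZ L_node eq_sym (negbTE ji) mul0r mulr0.
  - by rewrite map_inj_uniq // enum_uniq.
  - rewrite size_map size_enum_ord (leq_trans (size_polyD _ _)) // size_polyN geq_max sz_p.
    apply: (big_ind (fun q : {poly K} => size q <= m)%N) => [|q r qm rm|j _].
    + by rewrite size_poly0.
    + by rewrite (leq_trans (size_polyD _ _)) // geq_max qm.
    + by rewrite (leq_trans (size_scale_leq _ _)) // szL.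
rewrite [in RHS]pE coef_sum; apply: eq_bigr => j _.
by rewrite coefZ L_top mulr1.
Qed.

Definition grid_point N (f : {ffun 'I_N -> 'I_m}) : 'rV[K]_N := \row_k a (f k).

Lemma grid_point_inj N : injective (@grid_point N).
Proof.
by move=> f g /rowP fg; apply/ffunP => k; apply: a_inj; have := fg k; rewrite !mxE.
Qed.

(** The sum of a monomial factors over the variables; some variable occurs with
    an exponent less than m - 1, and the corresponding factor vanishes. *)
Lemma grid_sum_eq0 N (p : {mpoly K[N]}) : (msize p <= N * m.-1)%N ->
  \sum_f p.@[grid_point f 0] / \prod_k node_weight (f k) = 0.
Proof.
move=> p_small; under eq_bigr do rewrite mevalE mulr_suml.
rewrite exchange_big big_seq big1 //= => al alp.
have /existsP[k al_k] : [exists k, al k < m.-1]%N.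
  have := leq_trans (msize_mdeg_lt alp) p_small; apply: contraTT.
  rewrite negb_exists => /forallP al_m; rewrite -leqNgt mdegE.
  rewrite -[N in (N * _)%N]card_ord -sum_nat_const; apply: leq_sum => k _.
  by rewrite leqNgt.
transitivity (p@_al * \prod_k \sum_j a j ^+ al k / node_weight j).
  rewrite bigA_distr_bigA mulr_sumr; apply: eq_bigr => f _.
  rewrite -mulrA -prodf_div; congr (_ * _).
  by apply: eq_bigr => i _; rewrite mxE.
rewrite (bigD1 k) //= (_ : \sum_j _ = 0) ?mul0r ?mulr0 //.
transitivity (('X^(al k) : {poly K})`_m.-1); last by rewrite coefXn gtn_eqF.
rewrite -lagrange_top_coef ?size_polyXn; last exact: leq_trans al_k (leq_pred _).
by apply: eq_bigr => j _; rewrite hornerXn.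
Qed.

End Lagrange.

(** * The Euler-Jacobi vanishing theorem *)

Section EulerJacobi.
Variables (N d : nat) (K : closedFieldType).
Hypothesis ucK : uncountable K.
Variables F G : 'I_N -> {mpoly K[N]}.
Hypothesis F_homog : forall j, F j \is d.+1.-homog.
Hypothesis F_zero : forall z, (forall j, (F j).@[z] = 0) -> forall k, z k = 0.
Hypothesis G_top : forall j, (msize (F j - G j) <= d.+1)%N.
Hypothesis G_simple :
  forall z, (forall j, (G j).@[z] = 0) -> \det (jacobian_at G z) != 0.

(** Besides the coordinates of the zeros of G the nodes contain enough arbitrary
    elements for their number to be at least M. *)
Lemma zero_grid M : exists m (a : 'I_m -> K),
  [/\ (M <= m)%N, injective a
    & forall z, (forall j, (G j).@[z] = 0) -> forall k, exists i, z k = a i].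
Proof.
have [s sP] := finite_zero_coordinates ucK F_homog F_zero G_top.
have [_ /(_ M) [b [b_inj _]]] := uncountable_fiber (fun=> 0%N) ucK.
pose S := undup (s ++ codom b).
exists (size S), (tnth (in_tuple S)); split.
- rewrite -[M]card_ord -(size_codom b); apply: uniq_leq_size.
    by rewrite map_inj_uniq // enum_uniq.
  by move=> x xb; rewrite mem_undup mem_cat xb orbT.
- by apply/tuple_uniqP; rewrite undup_uniq.
move=> z Gz k; apply/tnthP.
have : z k \in S by rewrite mem_undup mem_cat (sP z Gz).
by [].
Qed.

(** The transformation law for residues: with h(x_k) = sum_j A_kj G_j, the sum of
    p / \det DG over the zeros of G is the sum of p \det A over the grid of zeros
    of (h(x_k))_k, divided by the products of the h'(x_k).  The degree of p \det A
    is less than N (m - 1), where m is the degree of h. *)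
Theorem euler_jacobi : exists Z : seq 'rV[K]_N,
  [/\ uniq Z, forall v, v \in Z <-> (forall j, (G j).@[v 0] = 0)
    & forall p, (msize p <= N * d)%N ->
        \sum_(v <- Z) p.@[v 0] / \det (jacobian_at G (v 0)) = 0].
Proof.
have [M1 [dM1 ctrl]] := generated_controlled ucK F_homog F_zero G_top.
have [m [a [M1m a_inj Z_grid]]] := zero_grid M1.
pose h k : {mpoly K[N]} := \prod_j ('X_k - (a j)%:MP).
have h_size k : (msize (h k) <= m.+1)%N.
  rewrite -[m in (_ <= m.+1)%N]muln1.
  apply: (graded_prod (P := fun e (p : {mpoly K[N]}) => msize p <= e.+1)%N).
  - by rewrite msize1.
  - by move=> e f x y; apply: msizeM_leS.
  - move=> j; apply: msizeB_le; first by rewrite msizeX mdeg1.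
    by rewrite msizeC; case: (_ != _).
have h_zero z k i : z k = a i -> (h k).@[z] = 0.
  move=> zk; rewrite /h rmorph_prod /= (bigD1 i) //=.
  by rewrite mevalB mevalXU mevalC zk subrr mul0r.
have /choice [A AP] : forall k, exists C : 'I_N -> {mpoly K[N]},
    (forall j, msize (C j) + d.+1 <= m.+1)%N /\ h k = \sum_j C j * G j.
  move=> k; have [|C Cm hE] := ctrl m.+1 (h k) (leqW M1m) (h_size k).
    apply: simple_zeros_radical => // z Gz.
    by have [i zk] := Z_grid z Gz k; apply: h_zero zk.
  by exists C.
pose AM := \matrix_(k, j) A k j.
have AM_size : (msize (\det AM) <= (N * (m - d.+1)).+1)%N.
  apply: (graded_det (P := fun e (p : {mpoly K[N]}) => msize p <= e.+1)%N).
  - by move=> e; rewrite msize0.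
  - by rewrite msize1.
  - by move=> e x; rewrite msizeN.
  - by move=> e x y xe ye; apply: leq_trans (msizeD_le _ _) _; rewrite geq_max xe.
  - by move=> e f x y; apply: msizeM_leS.
  - move=> k j; rewrite mxE -subSn ?(leq_trans dM1) //.
    by rewrite leq_subRL ?(leq_trans dM1 (leqW M1m)) // addnC; apply: (AP k).1.
pose zero (f : {ffun 'I_N -> 'I_m}) := [forall j, (G j).@[grid_point a f 0] == 0].
have zeroP f : reflect (forall j, (G j).@[grid_point a f 0] = 0) (zero f).
  by apply: (iffP forallP) => Gf j; apply/eqP; rewrite ?Gf.
pose w (f : {ffun 'I_N -> 'I_m}) := \prod_k node_weight a (f k).
(* A G = h(x) vanishes on the grid, so A is singular where G does not vanish *)
have detA_zero f : ~~ zero f -> (\det AM).@[grid_point a f 0] = 0.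
  move=> /zeroP nzf; apply/eqP; apply: contrapT => /negP detA0; apply: nzf => j.
  pose y : 'I_N -> K := grid_point a f 0.
  pose Gy := \col_j (G j).@[y].
  have : map_mx (meval y) AM *m Gy = 0.
    apply/colP => k; rewrite !mxE.
    transitivity (h k).@[y]; last by apply: (h_zero _ _ (f k)); rewrite /y mxE.
    rewrite (AP k).2 raddf_sum; apply: eq_bigr => i _.
    by rewrite !mxE /= mevalM.
  move/(congr1 (mulmx (invmx (map_mx (meval y) AM)))).
  rewrite mulKmx ?mulmx0 => [/colP/(_ j)|]; first by rewrite !mxE.
  by rewrite unitmxE det_map_mx unitfE.
(* where G vanishes, differentiating A G = h(x) gives A DG = diag(h') *)
have detA_simple f : zero f ->
    w f = (\det AM).@[grid_point a f 0] * \det (jacobian_at G (grid_point a f 0)).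
  move=> /zeroP Gf; set y := grid_point a f 0 in Gf *.
  rewrite -(det_map_mx (meval y)) -det_mulmx.
  have -> : map_mx (meval y) AM *m jacobian_at G y = diag_mx (\row_k node_weight a (f k)).
    apply/matrixP => k l; rewrite !mxE.
    transitivity ((h k)^`M(l)).@[y].
      rewrite (AP k).2 (raddf_sum (mderiv l)) raddf_sum; apply: eq_bigr => j _.
      by rewrite !mxE /= mderivM mevalD !mevalM Gf mulr0 add0r.
    rewrite /h (bigD1 (f k)) //= mderivM mevalD !mevalM mevalB mevalXU mevalC.
    rewrite [y k]mxE subrr mul0r addr0 mderivB mderivC subr0 mderivX mnm1E.
    case: (eqVneq k l) => [->|kl]; last by rewrite scale0r meval0 mul0r.
    rewrite (_ : (U_(l) - U_(l))%MM = 0%MM) ?scale1r ?mpolyX0 ?meval1 ?mul1r; last first.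
      by apply/mnmP => i; rewrite mnmBE subnn mnm0E.
    rewrite rmorph_prod /= mulr1n /node_weight; apply: eq_bigr => i _.
    by rewrite mevalB mevalXU mevalC [y l]mxE.
  by rewrite det_diag; apply: eq_bigr => k _; rewrite mxE.
exists [seq grid_point a f | f <- enum {: {ffun 'I_N -> 'I_m}} & zero f]; split.
- rewrite map_inj_uniq; last exact: (grid_point_inj a_inj).
  exact: (filter_uniq _ (enum_uniq _)).
- move=> v; split=> [/mapP[f] |Gv]; first by rewrite mem_filter => /andP[/zeroP Gf _] ->.
  have /choice [i iP] := Z_grid _ Gv.
  have vE : v = grid_point a [ffun k => i k] by apply/rowP => k; rewrite mxE ffunE iP.
  rewrite vE; apply: map_f; rewrite mem_filter mem_enum andbT.
  by apply/zeroP; rewrite -vE.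
move=> p p_small; rewrite big_map big_filter big_enum_cond /=.
rewrite -[RHS](@grid_sum_eq0 K m a a_inj N (p * \det AM)); last first.
  have [p0|p0] := posnP (msize p).
    by move/eqP: p0; rewrite mmeasure_poly_eq0 => /eqP ->; rewrite mul0r msize0.
  rewrite -(prednK p0) in p_small.
  apply: leq_trans (msizeM_leS (a := (msize p).-1) _ AM_size) _; first by rewrite prednK.
  rewrite -addSn; apply: leq_trans (leq_add p_small (leqnn _)) _.
  have dm : (d.+1 <= m)%N by apply: leq_trans M1m.
  by rewrite -mulnDr leq_mul2l -{2}(subnK dm) addnS /= addnC leqnn orbT.
rewrite [RHS](bigID zero) /= [X in _ = _ + X]big1 => [|f nzf].
  rewrite addr0; apply: eq_bigr => f zf.
  have wE := detA_simple f zf.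
  have w0 : w f != 0 by apply/prodf_neq0 => k _; apply: node_weight_neq0.
  have detA0 : (\det AM).@[grid_point a f 0] != 0.
    by apply: contraNneq w0 => A0; rewrite wE A0 mul0r.
  by rewrite -/(w f) wE mevalM [X in _ = _ / X]mulrC -mulf_div divff // mulr1.
by rewrite mevalM detA_zero // mulr0 mul0r.
Qed.

End EulerJacobi.

(** * Characteristic polynomials and the functions sigma *)

Section QuotientMatrix.
Variables (K : fieldType) (n : nat).

(** The endomorphism that D induces on K^(n+1) / <w>, when w is an eigenvector
    of D with w_i = 1, in the basis of the classes of the e_k, k <> i. *)
Definition quotient_mx (i : 'I_n.+1) (w : 'cV[K]_n.+1) (D : 'M[K]_n.+1) : 'M[K]_n :=
  \matrix_(j, k) (D (lift i j) (lift i k) - w (lift i j) 0 * D i (lift i k)).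

Lemma char_poly_quotient_mx i (w : 'cV[K]_n.+1) (D : 'M[K]_n.+1) c : w i 0 = 1 -> D *m w = c *: w ->
  char_poly D = ('X - c%:P) * char_poly (quotient_mx i w D).
Proof.
move=> wi Dw.
have [u uE] : exists u, u = w - delta_mx i 0 by exists (w - delta_mx i 0).
pose e : 'rV[K]_n.+1 := delta_mx 0 i.
have eu : e *m u = 0.
  by rewrite -rowE uE; apply/rowP => k; rewrite !mxE (ord1 k) wi !eqxx subrr.
have uee : (u *m e) *m (u *m e) = 0.
  by rewrite -mulmxA (mulmxA e u e) eu mul0mx mulmx0.
pose L := 1%:M - u *m e; pose U := 1%:M + u *m e.
have LU : L *m U = 1%:M.
  rewrite /L /U; move: (u *m e) uee => E E2.
  by rewrite mulmxDr mulmx1 mulmxBl mul1mx E2 subr0 subrK.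
have [D' D'def] : exists D', D' = L *m D *m U by exists (L *m D *m U).
have chiD' : char_poly D' = char_poly D.
  rewrite /char_poly; pose f := @polyC K.
  have -> : char_poly_mx D' = map_mx f L *m char_poly_mx D *m map_mx f U.
    rewrite /char_poly_mx mulmxBr mulmxBl D'def !map_mxM; congr (_ - _).
    by rewrite scalar_mxC -mulmxA -map_mxM LU map_mx1 mulmx1.
  by rewrite !det_mulmx mulrAC -det_mulmx -map_mxM LU map_mx1 det1 mul1r.
have D'E a b : D' a b = (D *m U) a b - u a 0 * (D *m U) i b.
  rewrite D'def -mulmxA mulmxBl mul1mx -mulmxA -rowE [LHS]mxE [X in _ + X]mxE.
  by congr (_ - _); rewrite [LHS]mxE big_ord1 [X in _ * X]mxE.
(* U sends the i-th basis vector to w, and L = U^-1: column i of D' is c times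
   the i-th basis vector *)
have DU_col a : (D *m U) a i = c * w a 0.
  have -> : (D *m U) a i = col i (D *m U) a 0 by rewrite [RHS]mxE.
  rewrite colE -mulmxA mulmxDl mul1mx -mulmxA.
  have -> : e *m delta_mx i 0 = 1%:M :> 'M_1.
    by rewrite mul_delta_mx; apply/matrixP => x y; rewrite (ord1 x) (ord1 y) !mxE.
  by rewrite mulmx1 uE addrC subrK Dw mxE.
have DU_other a k : (D *m U) a (lift i k) = D a (lift i k).
  rewrite mulmxDr mulmx1 mulmxA mxE [X in _ + X]mxE big_ord1 [e _ _]mxE.
  by rewrite [lift i k == i]eq_sym (negbTE (neq_lift i k)) andbF mulr0 addr0.
have u_lift j : u (lift i j) 0 = w (lift i j) 0.
  by rewrite uE !mxE [lift i j == i]eq_sym (negbTE (neq_lift i j)) subr0.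
have ui : u i 0 = 0 by rewrite uE !mxE wi !eqxx subrr.
rewrite -chiD' /char_poly (expand_det_col _ i) (bigD1 i) //= big1 => [|a ai].
  rewrite addr0 /cofactor row'_col'_char_poly_mx addnn -signr_odd odd_double expr0 mul1r.
  have -> : row' i (col' i D') = quotient_mx i w D.
    by apply/matrixP => j k; rewrite !mxE D'E !DU_other u_lift.
  by congr (_ * _); rewrite !mxE eqxx D'E ui mul0r subr0 DU_col wi mulr1.
rewrite !mxE (negbTE ai) D'E !DU_col wi mulr1.
case: (unliftP i a) ai => [j ->|->]; last by rewrite eqxx.
by rewrite u_lift [w _ _ * c]mulrC subrr mulr0n subr0 mul0r.
Qed.

End QuotientMatrix.

Section SigmaCoef.
Variable R : comNzRingType.
Implicit Types (p q : {poly R}) (c : R).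

(** The k-th elementary symmetric function of the roots of a monic p of degree
    N. *)
Definition sigma_coef N p k : R := (-1) ^+ k * p`_(N - k).

(** The same for the quotient of p by X - c, when c is a root of p. *)
Definition sigma_quotient c N p k : R :=
  \sum_(j < k.+1) (- c) ^+ j * sigma_coef N p (k - j).

Lemma sigma_quotientS c N p k :
  sigma_quotient c N p k.+1 = sigma_coef N p k.+1 - c * sigma_quotient c N p k.
Proof.
rewrite /sigma_quotient big_ord_recl expr0 mul1r subn0; congr (_ + _).
rewrite -mulNr mulr_sumr; apply: eq_bigr => j _.
by rewrite /= exprS mulrA subSS.
Qed.

Lemma sigma_coef_quotient c n q k : (size q <= n.+1)%N -> (k <= n)%N ->
  sigma_coef n q k = sigma_quotient c n.+1 (('X - c%:P) * q) k.
Proof.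
move=> sz_q; have coef_mulXsubC m : (('X - c%:P) * q)`_m.+1 = q`_m - c * q`_m.+1.
  by rewrite mulrBl coefB coefXM coefCM.
elim: k => [|k IHk] le_kn.
  rewrite /sigma_quotient big_ord1 expr0 mul1r /sigma_coef !subn0 coef_mulXsubC.
  by rewrite [q`_n.+1]nth_default ?mulr0 ?subr0.
rewrite sigma_quotientS -IHk 1?ltnW // /sigma_coef.
have -> : (n.+1 - k.+1 = (n - k.+1).+1)%N by rewrite subSn.
rewrite coef_mulXsubC (_ : (n - k.+1).+1 = (n - k)%N) 1?subnSK //.
by rewrite exprS; ring.
Qed.

End SigmaCoef.

Lemma sigma_coef_map (R S : comNzRingType) (f : {rmorphism R -> S}) N p k :
  sigma_coef N (map_poly f p) k = f (sigma_coef N p k).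
Proof. by rewrite /sigma_coef coef_map rmorphM rmorphXn rmorphN1. Qed.

Lemma sigma_quotient_map (R S : comNzRingType) (f : {rmorphism R -> S}) c N p k :
  sigma_quotient (f c) N (map_poly f p) k = f (sigma_quotient c N p k).
Proof.
rewrite rmorph_sum; apply: eq_bigr => j _.
by rewrite rmorphM rmorphXn rmorphN sigma_coef_map.
Qed.

Lemma sigmaE (K : numClosedFieldType) n (A : 'M[K]_n) k : (k <= n)%N ->
  sigma k A = sigma_coef n (char_poly A) k.
Proof.
move=> le_kn; rewrite /sigma /eigenvals; case: closed_field_poly_normal => r /=.
rewrite (monicP (char_poly_monic A)) scale1r => chiE.
have sz_r : size r == n.
  by rewrite -eqSS -(size_char_poly A) chiE size_prod_XsubC.
rewrite /sigma_coef chiE.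
have := mroots_coeff (Tuple sz_r) (Ordinal (le_kn : (k < n.+1)%N)) => /= ->.
by rewrite signrMK; apply: meval_eq => i; rewrite (tnth_nth 0).
Qed.

Section DegreeOfInvariants.
Variables (N : nat) (K : fieldType).

(** sigma_k is homogeneous of degree k in the entries of M. *)
Lemma char_poly_coef_size n e (M : 'M[{mpoly K[N]}]_n) k :
  (forall i j, msize (M i j) <= e.+1)%N -> (k <= n)%N ->
  (msize (sigma_coef n (char_poly M) k) <= (k * e).+1)%N.
Proof.
move=> Me le_kn.
(* the grading in which 'X and the entries of M have degree e *)
pose P a (x : {poly {mpoly K[N]}}) := forall i m, m \in msupp x`_i -> (mdeg m + i * e <= a)%N.
have PchiM : P (n * e)%N (char_poly M).
  apply: graded_det => [a i m|i m|a x Px i m|a x y Px Py i m|a b x y Px Py i m|i j l m].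
  - by rewrite coef0 msupp0.
  - rewrite coef1; case: eqP => [->|_]; last by rewrite msupp0.
    by rewrite msupp1 inE => /eqP ->; rewrite mdeg0.
  - by rewrite coefN (perm_mem (msuppN _)); apply: Px.
  - by rewrite coefD => /msuppD_le; rewrite mem_cat => /orP[/Px|/Py].
  - rewrite coefM => /msupp_sum_le /flattenP[_ /mapP[j _ ->]].
    move=> /msuppM_le /allpairsP[[m1 m2] [/= /Px m1a /Py m2b ->]].
    rewrite mdegD; have := leq_add m1a m2b; rewrite addnACA -mulnDl subnKC //.
    by rewrite -ltnS.
  - rewrite !mxE coefB coefMn coefX coefC => /msuppB_le; rewrite mem_cat => /orP[].
      case: (l =P 1%N) => [->|_]; last by rewrite mul0rn msupp0.
      case: (i == j); last by rewrite mulr0n msupp0.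
      by rewrite mulr1n msupp1 inE => /eqP ->; rewrite mdeg0 mul1n.
    case: eqP => [->|_]; last by rewrite msupp0.
    by rewrite mul0n addn0 => /msize_mdeg_lt lt_m; rewrite -ltnS (leq_trans lt_m).
apply/msize_leP => m; rewrite /sigma_coef -signr_odd mulr_sign.
have Pm : m \in msupp (char_poly M)`_(n - k) -> (mdeg m < (k * e).+1)%N.
  move=> /PchiM; rewrite mulnBl => le_m; rewrite ltnS.
  by rewrite -(leq_add2r (n * e - k * e)) subnKC // leq_mul2r le_kn orbT.
by case: odd => //; rewrite (perm_mem (msuppN _)).
Qed.

Lemma sigma_quotient_size n e (M : 'M[{mpoly K[N]}]_n) (c : K) k :
  (forall i j, msize (M i j) <= e.+1)%N -> (k <= n)%N ->
  (msize (sigma_quotient c%:MP n (char_poly M) k) <= (k * e).+1)%N.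
Proof.
move=> Me le_kn; apply: msize_sum_le => j _.
rewrite -mpolyCN -rmorphXn /= mul_mpolyC; apply: leq_trans (msizeZ_le _ _) _.
apply: leq_trans (char_poly_coef_size Me _) _; first exact: leq_trans (leq_subr _ _) le_kn.
by rewrite ltnS leq_mul2r leq_subr orbT.
Qed.

Lemma comp_mpoly_size n (Q : {mpoly K[n]}) (t : n.-tuple {mpoly K[N]}) wt W :
  (forall m, m \in msupp Q -> \sum_k m k * wt k <= W)%N ->
  (forall k, msize (tnth t k) <= (wt k).+1)%N ->
  (msize (Q \mPo t) <= W.+1)%N.
Proof.
move=> QW t_wt; rewrite comp_mpolyEX big_seq; apply: msize_sum_le => m mQ.
rewrite comp_mpolyX; apply: leq_trans (msizeZ_le _ _) _.
apply: leq_trans (_ : _ <= (\sum_k m k * wt k).+1)%N _; last by rewrite ltnS QW.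
pose Pb (p : {mpoly K[N]}) a := (msize p <= a.+1)%N.
apply: (big_rec2 Pb) => [|i a p _ pa]; first by rewrite /Pb msize1.
apply: msizeM_leS => //; elim: (m i) => [|l IHl]; first by rewrite expr0 msize1.
by rewrite exprS mulSn; apply: msizeM_leS.
Qed.

End DegreeOfInvariants.

Section WeightOfInvariants.
Variables (n : nat) (K : numClosedFieldType).
Hypothesis ucK : uncountable K.

(** The Nullstellensatz for the zero ideal. *)
Lemma mpoly_eq0_fun (p : {mpoly K[n]}) : (forall z, p.@[z] = 0) -> p = 0.
Proof.
move=> p0; have [||m /eqP] := @nullstellensatz n K ucK (fun q => q = 0) p.
- by split=> // [q r -> ->|q r ->]; rewrite ?addr0 ?mulr0.
- by move=> z _; apply: p0.
- by rewrite expf_eq0 => /andP[_ /eqP].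
Qed.

Lemma sigma_diag k (x : 'rV[K]_n) : (k <= n)%N ->
  sigma k (diag_mx x) = (mesym n K k).@[x 0].
Proof.
move=> le_kn; rewrite sigmaE // char_poly_trig ?diag_mx_is_trig //.
rewrite (_ : \prod_i _ = \prod_(c <- [tuple x 0 i | i < n]) ('X - c%:P)); last first.
  by rewrite big_map big_enum; apply: eq_bigr => i _; rewrite mxE eqxx mulr1n.
rewrite /sigma_coef (mroots_coeff _ (Ordinal (le_kn : (k < n.+1)%N))) signrMK.
by apply: meval_eq => i; rewrite tnth_mktuple.
Qed.

(** On diagonal matrices B is a symmetric polynomial of degree at most that of
    B, and Q expresses it in the elementary symmetric polynomials.  By
    uniqueness Q is the expression given by the fundamental theorem, which also
    bounds its weight. *)
Lemma sigma_weight (B : {mpoly K[(n * n)%N]}) (Q : {mpoly K[n]}) :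
  (forall A, mxpeval B A = Q.@[fun k : 'I_n => sigma k.+1 A]) ->
  (mweight Q <= maxn (msize B) 1)%N.
Proof.
move=> BQ.
pose S := [tuple mesym n K i.+1 | i < n].
pose E := mxvec (diag_mx (\row_i 'X_i)) : 'rV[{mpoly K[n]}]_(n * n).
pose t := [tuple E 0 k | k < (n * n)%N].
have QS : Q \mPo S = B \mPo t.
  apply/eqP; rewrite -subr_eq0; apply/eqP/mpoly_eq0_fun => z.
  rewrite mevalB !comp_mpoly_meval; apply/eqP; rewrite subr_eq0; apply/eqP.
  transitivity (mxpeval B (diag_mx (\row_i z i))).
    rewrite BQ; apply: meval_eq => k; rewrite tnth_mktuple sigma_diag //.
    by apply: meval_eq => i; rewrite mxE.
  apply: meval_eq => k; rewrite tnth_mktuple.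
  have -> : diag_mx (\row_i z i) = map_mx (meval z) (diag_mx (\row_i 'X_i)).
    by apply/matrixP => i j; rewrite !mxE raddfMn /= mevalXU.
  by rewrite -map_mxvec mxE.
have symQS : Q \mPo S \is symmetric.
  by apply: mcomp_sym => i; rewrite -tnth_nth tnth_mktuple mesym_sym.
have [q [qS q_wt]] := sym_fundamental symQS.
rewrite -(msym_fundamental_un qS); apply: leq_trans q_wt _; rewrite QS.
have [->|] := eqVneq B 0; first by rewrite comp_mpoly0 !msize0.
rewrite -(mmeasure_poly_eq0 mdeg) -lt0n => B0.
rewrite (maxn_idPl B0) -(prednK B0); apply: (comp_mpoly_size (wt := fun=> 1%N)) => [m mB|k].
  under eq_bigr do rewrite muln1.
  by rewrite -mdegE -ltnS prednK // msize_mdeg_lt.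
rewrite tnth_mktuple /E; case/mxvec_indexP: k => i j; rewrite mxvecE !mxE.
by case: (i == j); rewrite ?mulr1n ?mulr0n ?msize0 // msizeX mdeg1.
Qed.

End WeightOfInvariants.

(** * The Jacobian at a fixed point *)

Section FixedPoints.
Variables (K : fieldType) (n : nat).
Implicit Types (p q : projspace K n) (v w : 'rV[K]_n.+1) (i : 'I_n.+1).

Lemma mem_lineP p v : v \in val p <-> exists c, v = c *: hcoord p.
Proof.
have -> : val p = <[hcoord p]>%VS.
  apply/eqP; rewrite eq_sym eqEdim -memvE memv_pick /=.
  by rewrite (eqP (valP p)) dim_vline hcoord_neq0.
by split=> [/vlineP|] [c ->]; [exists c|rewrite memvZ ?memv_line].
Qed.

Lemma projspace_eq p q v : v != 0 -> v \in val p -> v \in val q -> p = q.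
Proof.
move=> v0 vp vq; apply: val_inj.
have lineE (r : projspace K n) : v \in val r -> val r = <[v]>%VS.
  move=> vr; apply/eqP; rewrite eq_sym eqEdim -memvE vr.
  by rewrite (eqP (valP r)) dim_vline v0.
by rewrite (lineE p vp) (lineE q vq).
Qed.

Lemma chart_mem i q v : v \in val q -> v != 0 ->
  chart i q = \row_j (v 0 (lift i j) / v 0 i).
Proof.
move=> /mem_lineP[c ->]; rewrite scaler_eq0 negb_or => /andP[c0 _].
apply/rowP => j; rewrite !mxE -mulf_div divff ?mul1r //.
Qed.

Lemma dehomog_chart i p : hcoord p 0 i != 0 ->
  dehomog i (chart i p) = (hcoord p 0 i)^-1 *: hcoord p.
Proof.
move=> pi0; apply/rowP => k; rewrite !mxE.
case: unliftP => [j ->|->]; last by rewrite mulVf.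
by rewrite mxE mulrC.
Qed.

End FixedPoints.

Section DifferentialOfPolynomials.
Variables (K : numFieldType) (n : nat).

Definition dehomog_eval (i : 'I_n.+1) (g : {mpoly K[n.+1]}) (z : 'rV[K]_n) : K :=
  g.@[dehomog i z 0].

Lemma is_diff_coord m j (z : 'rV[K]_m) :
  is_diff z (fun y : 'rV[K]_m => y 0 j : K) (fun u : 'rV[K]_m => u 0 j).
Proof.
have lin : linear (fun y : 'rV[K]_m => y 0 j : K) by move=> c u v; rewrite !mxE.
pose linM := GRing.isLinear.Build _ _ _ _ _ lin.
pose f : {linear 'rV[K]_m -> K} := HB.pack (fun y : 'rV[K]_m => y 0 j : K) linM.
have f_cont : continuous f by exact: coord_continuous.
apply: DiffDef; first exact: (linear_differentiable z f_cont).
exact: (diff_lin z f_cont).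
Qed.

Lemma is_diff_row m (phi dphi : 'I_m -> 'rV[K]_n -> K) (z : 'rV[K]_n) :
  (forall j, is_diff z (phi j) (dphi j)) ->
  is_diff z (fun y => \row_j phi j y : 'rV[K]_m) (fun u => \row_j dphi j u : 'rV[K]_m).
Proof.
move=> dP.
have df : differentiable (fun y => \row_j phi j y : 'rV[K]_m) z.
  rewrite (_ : (fun y => _) = \sum_j (fun y : 'rV[K]_n => phi j y *: delta_mx 0 j : 'rV[K]_m)).
    by apply: differentiable_sum => j; apply: differentiableZl; apply: ex_diff.
  apply/funext => y; rewrite fct_sumE [LHS]row_sum_delta.
  by apply: eq_bigr => j _; rewrite mxE.
apply: DiffDef => //; apply/funext => u; apply/rowP => j; rewrite mxE.
have [dc dcE] := is_diff_coord j ((fun y => \row_j phi j y : 'rV[K]_m) z).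
have := diff_comp df dc; rewrite dcE => /funeqP/(_ u) /= <-.
have [_ <-] := dP j; congr ('d _ z u).
by apply/funext => y /=; rewrite mxE.
Qed.

Lemma is_diff_dehomog_eval (i : 'I_n.+1) (g : {mpoly K[n.+1]}) (z : 'rV[K]_n) :
  is_diff z (dehomog_eval i g : 'rV[K]_n -> K)
    (fun u : 'rV[K]_n => \sum_j u 0 j * (g^`M(lift i j)).@[dehomog i z 0]).
Proof.
elim/mpoly_subring_ind: g => [c|k|p q dp dq|p q dp dq].
- rewrite (_ : dehomog_eval i c%:MP = cst c); last first.
    by apply/funext => y; rewrite /dehomog_eval mevalC.
  apply: is_diff_eq; apply/funext => u; rewrite big1 // => j _.
  by rewrite mderivC meval0 mulr0.
- case: (unliftP i k) => [j ->|->].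
    rewrite (_ : dehomog_eval i _ = (fun y : 'rV[K]_n => y 0 j)); last first.
      by apply/funext => y; rewrite /dehomog_eval mevalXU mxE liftK.
    apply: (is_diff_eq (is_diff_coord j z)); apply/funext => u.
    rewrite (bigD1 j) //= big1 => [|l lj].
      rewrite addr0 mderivX mnm1E eqxx scale1r.
      rewrite (_ : (_ - _)%MM = 0%MM) ?mpolyX0 ?meval1 ?mulr1 //.
      by apply/mnmP => l; rewrite mnmBE subnn mnm0E.
    by rewrite mderivX mnm1E (inj_eq lift_inj) eq_sym (negbTE lj) scale0r meval0 mulr0.
  rewrite (_ : dehomog_eval i _ = cst 1); last first.
    by apply/funext => y; rewrite /dehomog_eval mevalXU mxE unlift_none.
  apply: is_diff_eq; apply/funext => u; rewrite big1 // => j _.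
  by rewrite mderivX mnm1E (negbTE (neq_lift i j)) scale0r meval0 mulr0.
- rewrite (_ : dehomog_eval i _ = dehomog_eval i p + dehomog_eval i q); last first.
    by apply/funext => y; rewrite /dehomog_eval mevalD.
  apply: (is_diff_eq (is_diffD dp dq)); apply/funext => u.
  rewrite /= -[LHS]big_split; apply: eq_bigr => j _.
  by rewrite mderivD mevalD mulrDr.
rewrite (_ : dehomog_eval i _ = dehomog_eval i p * dehomog_eval i q); last first.
  by apply/funext => y; rewrite /dehomog_eval mevalM.
apply: (is_diff_eq (is_diffM dp dq)); apply/funext => u.
rewrite -[LHS]/(_ *: _ + _ *: _) !scaler_sumr -big_split; apply: eq_bigr => j _.
by rewrite mderivM mevalD !mevalM /dehomog_eval /GRing.scale /=; ring.
Qed.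

(** The quotient rule, for f written in the chart U_i. *)
Lemma jacobian_chart_quotient (i : 'I_n.+1) (F : 'I_n.+1 -> {mpoly K[n.+1]}) (z : 'rV[K]_n) :
  (F i).@[dehomog i z 0] != 0 ->
  (jacobian (fun y : 'rV[K]_n =>
     \row_j (dehomog_eval i (F (lift i j)) y / dehomog_eval i (F i) y) : 'rV[K]_n) z)^T
  = \matrix_(j, k) (((F (lift i j))^`M(lift i k)).@[dehomog i z 0] / (F i).@[dehomog i z 0]
      - (F (lift i j)).@[dehomog i z 0] * ((F i)^`M(lift i k)).@[dehomog i z 0]
        / (F i).@[dehomog i z 0] ^+ 2).
Proof.
move=> Fi0; apply/matrixP => j k; rewrite !mxE.
have dinv : is_diff z (fun y : 'rV[K]_n => (dehomog_eval i (F i) y)^-1)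
   (fun u : 'rV[K]_n => - (dehomog_eval i (F i) z) ^- 2 *
      \sum_l u 0 l * ((F i)^`M(lift i l)).@[dehomog i z 0]).
  have dFi := is_diff_dehomog_eval i (F i) z.
  apply: DiffDef; first by apply: differentiableV => //; apply: ex_diff.
  have [dF dFE] := dFi; rewrite diffV // dFE.
  by apply/funext => u.
have dquot l := is_diffM (is_diff_dehomog_eval i (F (lift i l)) z) dinv.
have [_ ->] := is_diff_row dquot; rewrite mxE.
rewrite -[LHS]/(_ * _ + _ * _) (bigD1 k) //= big1 => [|l lk]; last first.
  by rewrite mxE (negbTE lk) andbF mul0r.
rewrite [in X in _ + X](bigD1 k) //= big1 => [|l lk]; last first.
  by rewrite mxE (negbTE lk) andbF mul0r.
by rewrite mxE !eqxx !mul1r !addr0 /dehomog_eval; field.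
Qed.

End DifferentialOfPolynomials.

Section HomogeneousPolynomials.
Variables (R : idomainType) (N : nat).
Implicit Types (p : {mpoly R[N]}) (v : 'I_N -> R).

Lemma homog_meval_scale d p c v : p \is d.-homog ->
  p.@[fun k => c * v k] = c ^+ d * p.@[v].
Proof.
move=> /dhomogP p_homog; rewrite !mevalE mulr_sumr big_seq [RHS]big_seq.
apply: eq_bigr => m /p_homog <-; rewrite mulrCA; congr (_ * _).
under eq_bigr do rewrite exprMn.
by rewrite big_split /= -expr_sum -mdegE.
Qed.

Lemma homog_mderiv d p k : p \is d.-homog -> p^`M(k) \is d.-1.-homog.
Proof.
move=> /dhomogP p_homog; apply/dhomogP => m.
rewrite mcoeff_msupp mcoeff_mderiv => nz.
have : (m + U_(k))%MM \in msupp p.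
  by rewrite mcoeff_msupp; apply: contraNneq nz => ->; rewrite mul0rn.
by move/p_homog => /= <-; rewrite mdegD mdeg1 addn1.
Qed.

Lemma homog0_mderiv p k : p \is 0.-homog -> p^`M(k) = 0.
Proof. by move=> /dhomog_msize_le/msize1_polyC ->; rewrite mderivC. Qed.

Lemma euler_identity d p v : p \is d.-homog ->
  \sum_k (p^`M(k)).@[v] * v k = d%:R * p.@[v].
Proof.
move=> /dhomogP p_homog.
have -> : d%:R * p.@[v] = \sum_(m <- msupp p) (mdeg m)%:R * (p@_m *: 'X_[m]).@[v].
  rewrite {1}[p]mpolyE raddf_sum mulr_sumr big_seq [RHS]big_seq.
  by apply: eq_bigr => m /p_homog ->.
under eq_bigr => k _.
  rewrite {1}[p]mpolyE (raddf_sum (mderiv k)) raddf_sum mulr_suml.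
  over.
rewrite exchange_big; apply: eq_bigr => m _ /=.
rewrite mdegE natr_sum mulr_suml; apply: eq_bigr => k _.
have mE : (m k)%:R * ('X_[m - U_(k)].@[v] * v k) = (m k)%:R * 'X_[R, m].@[v].
  case mk: (m k) => [|l]; first by rewrite !mul0r.
  congr (_ * _); have {2}-> : m = (m - U_(k) + U_(k))%MM.
    rewrite submK //; apply/mnm_lepP => j; rewrite mnm1E.
    by case: eqP => [<-|//]; rewrite mk.
  by rewrite mpolyXD mevalM mevalXU.
by rewrite mderivZ mderivX !mevalZ -!mulrA mE mulrCA.
Qed.

End HomogeneousPolynomials.

Lemma char_poly_horner (K : comNzRingType) n (A : 'M[K]_n) a :
  (char_poly A).[a] = \det (a%:M - A).
Proof.
rewrite -horner_evalE -det_map_mx; congr (\det _); apply/matrixP => i j.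
by rewrite !mxE /= /horner_eval !hornerE hornerMn hornerX.
Qed.

Section Endomorphisms.
Variables (K : numClosedFieldType) (n d : nat) (f : projspace K n -> projspace K n).
Variable F : 'I_n.+1 -> {mpoly K[n.+1]}.
Hypothesis F_homog : forall i, F i \is d.-homog.
Hypothesis F_zero : forall v : 'rV[K]_n.+1, (forall i, (F i).@[v 0] = 0) -> v = 0.
Hypothesis F_f : forall (p : projspace K n) (v : 'rV[K]_n.+1), v \in val p ->
  (\row_i (F i).@[v 0]) \in val (f p).
Implicit Types (p : projspace K n) (v w : 'rV[K]_n.+1) (c lam : K).

Definition eigen lam v := forall j, (F j).@[v 0] = lam * v 0 j.

Lemma forms_neq0 v : v != 0 -> \row_i (F i).@[v 0] != 0.
Proof.
apply: contraNneq => /rowP Fv0; apply/eqP/F_zero => i.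
by have := Fv0 i; rewrite !mxE.
Qed.

Lemma eigen_neq0 lam v : v != 0 -> eigen lam v -> lam != 0.
Proof.
move=> v0 Fv; apply: contraNneq (forms_neq0 v0) => lam0.
by apply/eqP/rowP => i; rewrite !mxE Fv lam0 mul0r.
Qed.

Lemma fixed_eigen p v : f p = p -> v != 0 -> v \in val p -> exists lam, eigen lam v.
Proof.
move=> fp v0 vp; have := F_f vp; rewrite fp => /mem_lineP[a /rowP Fv].
have /mem_lineP[b vE] := vp.
have b0 : b != 0 by apply: contraNneq v0 => b0; rewrite vE b0 scale0r.
exists (a / b) => j; have := Fv j; rewrite mxE => ->.
by rewrite vE !mxE mulrA divfK.
Qed.

Lemma eigen_fixed lam p v : v != 0 -> v \in val p -> eigen lam v -> f p = p.
Proof.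
move=> v0 vp Fv; apply: (projspace_eq (forms_neq0 v0)); first exact: F_f.
have -> : \row_i (F i).@[v 0] = lam *: v by apply/rowP => j; rewrite !mxE Fv.
by rewrite memvZ.
Qed.

Lemma meval_scale i c v : (F i).@[(c *: v) 0] = c ^+ d * (F i).@[v 0].
Proof.
rewrite -(homog_meval_scale _ _ (F_homog i)).
by apply: meval_eq => k; rewrite mxE.
Qed.

Lemma jacobian_at_scale c v :
  jacobian_at F ((c *: v) 0) = c ^+ d.-1 *: jacobian_at F (v 0).
Proof.
apply/matrixP => j k; rewrite !mxE -(homog_meval_scale _ _ (homog_mderiv k (F_homog j))).
by apply: meval_eq => l; rewrite mxE.
Qed.

Lemma jacobian_at_euler v :
  jacobian_at F (v 0) *m v^T = d%:R *: (\row_i (F i).@[v 0])^T.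
Proof.
apply/colP => j; rewrite !mxE -euler_identity //.
by apply: eq_bigr => k _; rewrite !mxE.
Qed.

(** With w = v / v_i, f is F_j / F_i in the chart U_i and F(w) = mu w, so the
    quotient rule gives the entries d_k F_j(w) / mu - w_j d_k F_i(w) / mu; passing
    from w to v rescales DF and mu by matching powers of v_i. *)
Lemma Jac_quotient p lam v : f p = p -> v != 0 -> v \in val p -> eigen lam v ->
  let i := chart_at p in
  v 0 i != 0 /\
  Jac f p = quotient_mx i ((v 0 i)^-1 *: v)^T (lam^-1 *: jacobian_at F (v 0)).
Proof.
move=> fp v0 vp Fv i.
have lam0 := eigen_neq0 v0 Fv.
have /mem_lineP[b vE] := vp.
have b0 : b != 0 by apply: contraNneq v0 => b0; rewrite vE b0 scale0r.
have hi0 : hcoord p 0 i != 0 := chart_atP p.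
have vi0 : v 0 i != 0 by rewrite vE mxE mulf_neq0.
split=> //.
have wE : dehomog i (chart i p) = (v 0 i)^-1 *: v.
  by rewrite dehomog_chart // {2}vE scalerA vE mxE invfM mulrAC mulVf // mul1r.
set w := (v 0 i)^-1 *: v in wE *.
have wi : w 0 i = 1 by rewrite mxE mulVf.
have Fw j : (F j).@[w 0] = (v 0 i)^-1 ^+ d * lam * v 0 i * w 0 j.
  by rewrite meval_scale Fv -!mulrA [in RHS]mxE mulVKf.
set mu := _ * _ * v 0 i in Fw.
have mu0 : mu != 0 by rewrite !mulf_neq0 // expf_neq0 // invr_neq0.
rewrite /Jac -/i.
have -> : (fun z : 'rV[K]_n => chart i (f (unchart i z))) =
  (fun y : 'rV[K]_n => \row_j (dehomog_eval i (F (lift i j)) y / dehomog_eval i (F i) y)).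
  apply/funext => z; rewrite (@chart_mem _ _ i _ (\row_k (F k).@[dehomog i z 0])).
  - by apply/rowP => j; rewrite !mxE.
  - by apply: F_f; apply: memv_line.
  - by apply: forms_neq0; apply: dehomog_neq0.
rewrite jacobian_chart_quotient wE; last by rewrite Fw wi mulr1.
have DE j k : lam^-1 * ((F j)^`M(k)).@[v 0] = mu^-1 * ((F j)^`M(k)).@[w 0].
  have := jacobian_at_scale (v 0 i)^-1 v => /matrixP/(_ j k); rewrite !mxE -/w => ->.
  rewrite mulrA /mu; case: (d) F_homog => [|d'] F_hom.
    by rewrite homog0_mderiv // meval0 !mulr0.
  by congr (_ * _); rewrite exprS; field; rewrite vi0 lam0 expf_neq0 ?invr_neq0.
apply/matrixP => j k; rewrite [LHS]mxE !Fw wi mulr1.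
rewrite [RHS]mxE ![(_ *: jacobian_at _ _) _ _]mxE ![jacobian_at _ _ _ _]mxE !DE.
rewrite [_^T _ _]mxE; field.
exact: mu0.
Qed.

(** By Euler's identity v is an eigenvector, with eigenvalue d. *)
Lemma char_poly_fixed p lam v : f p = p -> v != 0 -> v \in val p -> eigen lam v ->
  char_poly (lam^-1 *: jacobian_at F (v 0)) = ('X - d%:R%:P) * char_poly (Jac f p).
Proof.
move=> fp v0 vp Fv; have [vi0 ->] := Jac_quotient fp v0 vp Fv.
have lam0 := eigen_neq0 v0 Fv.
apply: char_poly_quotient_mx; first by rewrite !mxE mulVf.
rewrite linearZ /= -scalemxAl -scalemxAr jacobian_at_euler.
by apply/colP => j; rewrite !mxE Fv; field; rewrite ?lam0 ?vi0.
Qed.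

End Endomorphisms.

(** * The fixed point formula over an uncountable algebraically closed field *)

Section LineOf.
Variables (K : fieldType) (n : nat).
Implicit Types (p : projspace K n) (v : 'rV[K]_n.+1).

(** A total version of [line], with an arbitrary value at 0. *)
Definition line_of v : projspace K n :=
  insubd (line (dehomog_neq0 ord0 (0 : 'rV[K]_n))) <[v]>%VS.

Lemma mem_line_of v : v != 0 -> v \in val (line_of v).
Proof. by move=> v0; rewrite val_insubd dim_vline v0 memv_line. Qed.

Lemma mem_line_ofP v w : v != 0 -> w \in val (line_of v) -> exists c, w = c *: v.
Proof. by move=> v0; rewrite val_insubd dim_vline v0 => /vlineP. Qed.

Lemma line_of_eq p v : v != 0 -> v \in val p -> line_of v = p.
Proof. by move=> v0 vp; apply: projspace_eq (mem_line_of v0) vp. Qed.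

End LineOf.

Lemma roots_of_unity_seq (K : numClosedFieldType) m : (0 < m)%N ->
  exists r : seq K, [/\ uniq r, size r = m & forall c, (c \in r) = (c ^+ m == 1)].
Proof.
move=> m0; have [r rE] := closed_field_poly_normal ('X^m - 1 : {poly K}).
have monic_Xm : ('X^m - 1 : {poly K}) \is monic by apply: monicXnsubC.
rewrite (monicP monic_Xm) scale1r in rE.
exists r; split=> [||c].
- rewrite -separable_prod_XsubC -rE.
  by apply: separable_Xn_sub_1; rewrite pnatr_eq0 -lt0n.
- by apply: succn_inj; rewrite -(size_prod_XsubC r id) -rE size_XnsubC.
- by rewrite -root_prod_XsubC -rE rootE !hornerE subr_eq0.
Qed.

Section FixedPointFormula.
Variables (K : numClosedFieldType) (n d : nat) (f : projspace K n -> projspace K n).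
Hypothesis ucK : uncountable K.
Variable F : 'I_n.+1 -> {mpoly K[n.+1]}.
Hypothesis F_homog : forall i, F i \is d.-homog.
Hypothesis F_zero : forall v : 'rV[K]_n.+1, (forall i, (F i).@[v 0] = 0) -> v = 0.
Hypothesis F_f : forall (p : projspace K n) (v : 'rV[K]_n.+1), v \in val p ->
  (\row_i (F i).@[v 0]) \in val (f p).
Hypothesis f_simple : forall p, f p = p -> \det (1%:M - Jac f p) != 0.
Variables (B : {mpoly K[(n * n)%N]}) (Q : {mpoly K[n]}).
Hypothesis B_sigma : forall A : 'M[K]_n,
  mxpeval B A = Q.@[fun k : 'I_n => sigma k.+1 A].
Hypothesis Q_weight : (mweight Q <= n.+1)%N.
Implicit Types (p : projspace K n) (v w : 'rV[K]_n.+1) (c lam : K).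

(** The value of Q(sigma_1, ..., sigma_n) on the endomorphism that M induces on
    the quotient by an eigenvector of eigenvalue d. *)
Definition sigma_eval (M : 'M[K]_n.+1) : K :=
  Q.@[fun k : 'I_n => sigma_quotient d%:R n.+1 (char_poly M) k.+1].

Lemma mxpeval_Jac p lam v : f p = p -> v != 0 -> v \in val p -> eigen F lam v ->
  mxpeval B (Jac f p) = sigma_eval (lam^-1 *: jacobian_at F (v 0)).
Proof.
move=> fp v0 vp Fv; rewrite B_sigma; apply: meval_eq => k.
rewrite sigmaE // (char_poly_fixed F_homog F_zero F_f fp v0 vp Fv).
by rewrite -sigma_coef_quotient // size_char_poly.
Qed.

Lemma det_Jac p lam v : f p = p -> v != 0 -> v \in val p -> eigen F lam v ->
  \det (1%:M - lam^-1 *: jacobian_at F (v 0)) = (1 - d%:R) * \det (1%:M - Jac f p).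
Proof.
move=> fp v0 vp Fv; rewrite -!char_poly_horner.
by rewrite (char_poly_fixed F_homog F_zero F_f fp v0 vp Fv) hornerM hornerXsubC.
Qed.

Lemma sigma_eval0 : sigma_eval 0 = Q.@[fun k : 'I_n => (- d%:R) ^+ k.+1].
Proof.
apply: meval_eq => k.
have -> : char_poly (0 : 'M[K]_n.+1) = 'X^(n.+1).
  by rewrite /char_poly /char_poly_mx map_mx0 subr0 det_scalar.
rewrite /sigma_quotient big_ord_recr /= subnn big1 => [|j _].
  by rewrite add0r /sigma_coef expr0 mul1r subn0 coefXn eqxx mulr1.
rewrite /sigma_coef coefXn (_ : (_ == _) = false) ?mulr0 //.
apply/negbTE; rewrite neq_ltn ltn_subrL subn_gt0 ltnS /=.
by rewrite -ltnS ltn_ord.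
Qed.

(** The degree bound comes from the weight of Q, as sigma_k has degree at most
    k e in the variables. *)
Lemma sigma_eval_mpoly N e (M : 'M[{mpoly K[N]}]_n.+1) :
  (forall i j, msize (M i j) <= e.+1)%N ->
  exists2 P : {mpoly K[N]}, (msize P <= (n * e).+1)%N
    & forall z, P.@[z] = sigma_eval (map_mx (meval z) M).
Proof.
move=> Me.
pose t := [tuple sigma_quotient (d%:R)%:MP n.+1 (char_poly M) k.+1 | k < n].
exists (Q \mPo t) => [|z].
  apply: (comp_mpoly_size (wt := fun k : 'I_n => (k.+1 * e)%N)) => [m mQ|k]; last first.
    by rewrite tnth_mktuple; apply: sigma_quotient_size => //; apply: leqW.
  under eq_bigr do rewrite mulnA.
  rewrite -big_distrl /= leq_mul2r; apply/orP; right.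
  by rewrite -ltnS; apply: leq_trans Q_weight; apply: mmeasure_mnm_lt mQ.
rewrite comp_mpoly_meval; apply: meval_eq => k; rewrite tnth_mktuple.
by rewrite -(sigma_quotient_map (meval z)) /= mevalC map_char_poly.
Qed.

Definition index_term p : K := mxpeval B (Jac f p) / \det (1%:M - Jac f p).

Definition fixed_point_formula : Prop :=
  exists2 ps : seq (projspace K n), uniq ps /\ (forall p, p \in ps <-> f p = p)
    & \sum_(p <- ps) index_term p = Q.@[fun k : 'I_n => (- d%:R) ^+ k.+1].


Lemma eigen_scale lam c v : (0 < d)%N -> eigen F lam v -> eigen F (c ^+ d.-1 * lam) (c *: v).
Proof.
move=> d0 Fv j; rewrite (meval_scale F_homog) Fv mxE -{1}(prednK d0) exprS.
by rewrite -!mulrA mulrCA; congr (_ * _); rewrite mulrCA.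
Qed.

Lemma eigen_uniq lam mu v : v != 0 -> eigen F lam v -> eigen F mu v -> lam = mu.
Proof.
move=> v0 Fv Fv'; apply/eqP; rewrite -subr_eq0; apply: contraNT v0 => nz.
apply/eqP/rowP => j; apply: (mulfI nz).
by rewrite mulrBl -Fv -Fv' subrr mxE mulr0.
Qed.

Lemma eigen_fixed_line lam v : v != 0 -> eigen F lam v -> f (line_of v) = line_of v.
Proof. by move=> v0; apply: (eigen_fixed F_zero F_f v0 (mem_line_of v0)). Qed.

(** The vectors c v0 with F(c v0) = c v0 are those with c^(d-1) = 1. *)
Lemma eigen1_count v0 (s : seq 'rV[K]_n.+1) : (1 < d)%N ->
  uniq s -> (forall v, v \in s <-> v != 0 /\ eigen F 1 v) -> v0 \in s ->
  count (fun v => line_of v == line_of v0) s = d.-1.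
Proof.
move=> d1 s_uniq sP v0s; have [v00 Fv0] := (sP v0).1 v0s.
have d0 : (0 < d)%N := ltnW d1; have dm0 : (0 < d.-1)%N by rewrite -subn1 subn_gt0.
have [r [r_uniq r_size rP]] := roots_of_unity_seq K dm0.
rewrite -size_filter -r_size -(size_map (fun c => c *: v0)); apply/perm_size/uniq_perm.
- exact: filter_uniq.
- rewrite map_inj_uniq // => c c' /eqP.
  by rewrite -subr_eq0 -scalerBl scaler_eq0 (negbTE v00) orbF subr_eq0 => /eqP.
move=> v; apply/idP/mapP => [|[c]].
  rewrite mem_filter => /andP[/eqP vv0 vs]; have [v_neq0 Fv] := (sP v).1 vs.
  have [c vE] : exists c, v = c *: v0.
    by apply: mem_line_ofP => //; rewrite -vv0 mem_line_of.
  exists c => //; rewrite rP; apply/eqP; apply: (eigen_uniq v_neq0) Fv.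
  by have := eigen_scale c d0 Fv0; rewrite mulr1 vE.
rewrite rP => /eqP cd ->; rewrite mem_filter.
have c0 : c != 0 by apply: contra_eq_neq cd => ->; rewrite expr0n -[d.-1]prednK // eq_sym oner_eq0.
have cv0 : c *: v0 != 0 by rewrite scaler_eq0 negb_or c0.
apply/andP; split.
  by apply/eqP/line_of_eq => //; rewrite memvZ // mem_line_of.
by apply/sP; split=> //; have := eigen_scale c d0 Fv0; rewrite cd mulr1.
Qed.

(** [euler_jacobi] for G(v) = v - F(v): the degree n (d - 1) of the numerator is
    less than (n + 1) (d - 1) because d >= 2. *)
Lemma fixed_point_formula_ge2 : (1 < d)%N -> fixed_point_formula.
Proof.
move=> d1; have d0 : (0 < d)%N := ltnW d1.
have dm0 : (0 < d.-1)%N by rewrite -subn1 subn_gt0.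
pose G j : {mpoly K[n.+1]} := 'X_j - F j.
have GE j z : (G j).@[z] = z j - (F j).@[z] by rewrite mevalB mevalXU.
have jacG z : jacobian_at G z = 1%:M - jacobian_at F z.
  apply/matrixP => j k; rewrite !mxE mderivB mevalB; congr (_ - _).
  rewrite mderivX mnm1E; case: eqP => [->|_]; last by rewrite scale0r meval0.
  rewrite scale1r (_ : (_ - _)%MM = 0%MM) ?mpolyX0 ?meval1 //.
  by apply/mnmP => l; rewrite mnmBE subnn mnm0E.
have jac0 : jacobian_at F ((0 : 'rV[K]_n.+1) 0) = 0.
  have := jacobian_at_scale F_homog 0 0.
  by rewrite scale0r expr0n -[d.-1]prednK //= scale0r.
have row_eval (p : {mpoly K[n.+1]}) (z : 'I_n.+1 -> K) : p.@[(\row_k z k) 0] = p.@[z].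
  by apply: meval_eq => k; rewrite mxE.
have row_jac z : jacobian_at F ((\row_k z k) 0) = jacobian_at F z.
  by apply/matrixP => j k; rewrite !mxE row_eval.
have G_eigen v : (forall j, (G j).@[v 0] = 0) <-> eigen F 1 v.
  split=> Gv j; first by have /eqP := Gv j; rewrite GE subr_eq0 mul1r => /eqP.
  by rewrite GE Gv mul1r subrr.
have det_fixed v : v != 0 -> eigen F 1 v ->
    \det (1%:M - jacobian_at F (v 0)) =
    (1 - d%:R) * \det (1%:M - Jac f (line_of v)).
  move=> v0 Fv; rewrite -(det_Jac (eigen_fixed_line v0 Fv) v0 (mem_line_of v0) Fv).
  by rewrite invr1 scale1r.
have d_neq1 : 1 - d%:R != 0 :> K.
  by rewrite subr_eq0 eq_sym -[1]/(1%:R) eqr_nat gtn_eqF.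
have [|||z Gz|Zs [Zs_uniq ZsP EJ]] :=
    @euler_jacobi n.+1 d.-1 K ucK (fun j => - F j) G.
- by move=> j; rewrite dhomogN prednK.
- move=> z Fz k; have : \row_k z k = 0.
    apply: F_zero => i; rewrite row_eval; apply/eqP; rewrite -oppr_eq0 -mevalN.
    by rewrite Fz.
  by move/rowP/(_ k); rewrite !mxE.
- move=> j; rewrite /G opprB addKr msizeN.
  by rewrite msizeX mdeg1 prednK.
- rewrite jacG -row_jac; have [->|v0] := eqVneq (\row_k z k) 0.
    by rewrite jac0 subr0 det1 oner_eq0.
  have Fv : eigen F 1 (\row_k z k) by apply/G_eigen => j; rewrite row_eval.
  by rewrite det_fixed // mulf_neq0 // f_simple // (eigen_fixed_line v0 Fv).
have [|P P_size PE] := @sigma_eval_mpoly n.+1 d.-1 (\matrix_(j, k) (F j)^`M(k)).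
  by move=> j k; rewrite mxE; apply/dhomog_msize_le/homog_mderiv.
have {}PE z : P.@[z] = sigma_eval (jacobian_at F z).
  by rewrite PE; congr sigma_eval; apply/matrixP => j k; rewrite !mxE.
have := EJ P; rewrite (leq_trans P_size); last by rewrite mulSn -addn1 addnC leq_add2r.
move=> /(_ isT).
have Z0 : 0 \in Zs.
  apply/ZsP/G_eigen => j; rewrite !mxE mulr0.
  by have := meval_scale F_homog j 0 0; rewrite scale0r expr0n -[d]prednK //= mul0r.
rewrite (bigD1_seq 0) //= PE jacG jac0 subr0 det1 divr1 sigma_eval0.
pose nz := [seq v <- Zs | v != 0].
have nzP v : v \in nz <-> v != 0 /\ eigen F 1 v.
  rewrite mem_filter; split=> [/andP[v0 /ZsP/G_eigen]|[-> /G_eigen/ZsP]] //.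
have nz_uniq : uniq nz by apply: filter_uniq.
rewrite -big_filter -/nz => sum0.
pose ps := undup [seq line_of v | v <- nz].
exists ps.
  split=> [|p]; first exact: undup_uniq.
  rewrite mem_undup; split=> [/mapP[v /nzP[v0 Fv] ->]|fp].
    exact: eigen_fixed_line Fv.
  have h0 := hcoord_neq0 p; have hp : hcoord p \in val p by apply: memv_pick.
  have [lam Fh] := fixed_eigen F_f fp h0 hp.
  have lam0 := eigen_neq0 F_zero h0 Fh.
  (* rescaling by c turns F(v) = lam v into F(c v) = c v *)
  pose c := (d.-1).-root (lam^-1).
  have cd : c ^+ d.-1 = lam^-1 by apply: rootCK.
  have c0 : c != 0.
    by apply: contra_eq_neq cd => ->; rewrite expr0n -[d.-1]prednK //= eq_sym invr_eq0.
  have v0 : c *: hcoord p != 0 by rewrite scaler_eq0 negb_or c0.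
  have -> : p = line_of (c *: hcoord p) by rewrite (@line_of_eq _ _ p) // memvZ.
  apply: map_f; apply/nzP; split=> //.
  by have := eigen_scale c d0 Fh; rewrite cd mulVf.
(* at v = 0 the sum has the term Q(-d, ..., (-d)^n); the others come in groups of
   d - 1, one group for each fixed point *)
have nz_term v : v \in nz ->
    P.@[v 0] / \det (jacobian_at G (v 0)) = (1 - d%:R)^-1 * index_term (line_of v).
  move=> /nzP[v0 Fv]; rewrite PE jacG det_fixed // /index_term.
  rewrite (mxpeval_Jac (eigen_fixed_line v0 Fv) v0 (mem_line_of v0) Fv).
  by rewrite invr1 scale1r invfM mulrCA.
rewrite (eq_big_seq _ nz_term) -mulr_sumr in sum0.
have termE : \sum_(v <- nz) index_term (line_of v) = (d%:R - 1) * \sum_(p <- ps) index_term p.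
  rewrite -(big_map (@line_of K n) xpredT) -big_undup_iterop_count mulr_sumr.
  apply: eq_big_seq => p; rewrite mem_undup => /mapP[v vnz ->].
  rewrite -[LHS]/(_ *+ _) count_map (eigen1_count d1 nz_uniq nzP vnz).
  by rewrite -subn1 mulrnBr // mulr1n mulrBl mul1r mulr_natl.
move: sum0; rewrite termE mulrA -(opprB 1 d%:R) mulrN mulVf // mulN1r.
by move/eqP; rewrite subr_eq0 => /eqP ->.
Qed.


(** f is constant and its Jacobian matrix vanishes. *)
Lemma fixed_point_formula_0 : d = 0%N -> fixed_point_formula.
Proof.
move=> d0; have Fh j : F j \is 0.-homog by have := F_homog j; rewrite d0.
pose c := \row_i (F i).@[(0 : 'rV[K]_n.+1) 0].
have Fc v : \row_i (F i).@[v 0] = c.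
  by apply/rowP => i; rewrite !mxE (msize1_polyC (dhomog_msize_le (Fh i))) !mevalC.
have c0 : c != 0.
  by rewrite -(Fc (dehomog ord0 0)) (forms_neq0 F_zero) // dehomog_neq0.
have c_f p : c \in val (f p) by rewrite -(Fc (hcoord p)) F_f ?memv_pick.
have fixP p : p = line_of c <-> f p = p.
  split=> [->|fp]; first by apply/esym/line_of_eq.
  by apply/esym/line_of_eq => //; rewrite -fp.
exists [:: line_of c]; first by split=> // p; rewrite inE -fixP; split=> /eqP.
rewrite big_seq1; have fp := (fixP _).1 (erefl (line_of c)).
have cp := mem_line_of c0.
have [lam Fl] := fixed_eigen F_f fp c0 cp.
have jac0 : jacobian_at F (c 0) = 0.
  by apply/matrixP => j k; rewrite !mxE homog0_mderiv ?meval0.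
have detE : \det (1%:M - Jac f (line_of c)) = 1.
  by have := det_Jac fp c0 cp Fl; rewrite jac0 scaler0 subr0 det1 d0 subr0 mul1r.
by rewrite /index_term detE divr1 (mxpeval_Jac fp c0 cp Fl) jac0 scaler0 sigma_eval0.
Qed.

(** The class of u in K^(n+1) / <v> is fixed by the Jacobian matrix at p, which
    has no eigenvalue 1; so it is zero. *)
Lemma fixed_eigenspace p lam v u : f p = p -> v != 0 -> v \in val p -> eigen F lam v ->
  jacobian_at F (v 0) *m u^T = lam *: u^T -> u \in val p.
Proof.
move=> fp v0 vp Fv Du.
have lam0 := eigen_neq0 F_zero v0 Fv.
have [vi0 JE] := Jac_quotient F_homog F_zero F_f fp v0 vp Fv.
set i := chart_at p in vi0 JE; set w := _ *: v in JE; set D := _ *: jacobian_at F _ in JE.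
have wi : w 0 i = 1 by rewrite mxE mulVf.
have Dw : D *m w^T = d%:R *: w^T.
  rewrite linearZ /= -scalemxAr -scalemxAl (jacobian_at_euler F_homog).
  by apply/colP => j; rewrite !mxE Fv; field; rewrite vi0 lam0.
have Du1 : D *m u^T = u^T by rewrite -scalemxAl Du scalerA mulVf // scale1r.
(* the representative of u modulo w in the hyperplane y_i = 0 *)
pose y := u - u 0 i *: w.
have yi : y 0 i = 0 by rewrite mxE [X in _ + X]mxE [X in _ - X]mxE wi mulr1 subrr.
have Dy a : \sum_k D a k * y 0 k = u 0 a - u 0 i * (d%:R * w 0 a).
  transitivity ((D *m y^T) a 0).
    by rewrite [RHS]mxE; apply: eq_bigr => k _; rewrite [y^T _ _]mxE.
  by rewrite raddfB /= linearZ /= mulmxBr -scalemxAr Du1 Dw !mxE.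
pose x := \col_k y 0 (lift i k).
have Jx : Jac f p *m x = x.
  apply/colP => j; rewrite JE [LHS]mxE [RHS]mxE.
  under eq_bigr => k _ do rewrite mxE [x _ _]mxE [w^T _ _]mxE.
  transitivity (\sum_k (D (lift i j) k - w 0 (lift i j) * D i k) * y 0 k).
    by rewrite (bigD1_ord i) //= yi mulr0 add0r.
  under eq_bigr do rewrite mulrBl -mulrA.
  rewrite sumrB -mulr_sumr !Dy wi [y]lock !mxE -lock /y !mxE.
  by ring.
have x0 : x = 0.
  have J1 : 1%:M - Jac f p \in unitmx by rewrite unitmxE unitfE f_simple.
  by rewrite -(mulKmx J1 x) mulmxBl mul1mx Jx subrr mulmx0.
have -> : u = (u 0 i / v 0 i) *: v; last by rewrite memvZ.
rewrite -scalerA -/w; apply/eqP; rewrite -subr_eq0; apply/eqP/rowP => k; rewrite -/y.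
rewrite [RHS]mxE; case: (unliftP i k) => [j ->|->]; last exact: yi.
by have /colP/(_ j) := x0; rewrite !mxE.
Qed.

Lemma char_poly_scale (D : 'M[K]_n.+1) lam : lam != 0 ->
  char_poly D \Po (lam *: 'X) = lam ^+ n.+1 *: char_poly (lam^-1 *: D).
Proof.
move=> lam0; rewrite /char_poly -det_map_mx -[RHS]mul_polyC polyC_exp -detZ.
congr (\det _); apply/matrixP => i j; rewrite !mxE rmorphB rmorphMn /=.
rewrite comp_polyX comp_polyC mulrBr mulrnAr mul_polyC -rmorphM /= mulrA.
by rewrite mulfV // mul1r.
Qed.

(** R is the reciprocal polynomial of P, in degree n. *)
Lemma homogenize_at_inv (P : {mpoly K[1]}) : (msize P <= n.+1)%N ->
  exists2 R : {poly K}, (size R <= n.+1)%N /\ R`_n = P.@[fun=> 0]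
    & forall x, x != 0 -> R.[x] = x ^+ n * P.@[fun=> x^-1].
Proof.
move=> /msize_leP P_size.
have deg1 (m : 'X_{1..1}) x : \prod_i (x : K) ^+ m i = x ^+ mdeg m by rewrite mdegE !big_ord1.
exists (\sum_(m <- msupp P) P@_m *: 'X^(n - mdeg m)); first split.
- apply: (big_ind (fun q : {poly K} => size q <= n.+1)%N) => [|q r qn rn|m _].
  + by rewrite size_poly0.
  + by rewrite (leq_trans (size_polyD _ _)) // geq_max qn.
  + by rewrite (leq_trans (size_scale_leq _ _)) // size_polyXn ltnS leq_subr.
- rewrite coef_sum mevalE big_seq [RHS]big_seq; apply: eq_bigr => m /P_size le_m.
  rewrite deg1 coefZ coefXn expr0n; congr (_ * _%:R).
  by rewrite -[n in n == _]subn0 eqn_sub2lE // eq_sym.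
move=> x x0; rewrite horner_sum mevalE mulr_sumr big_seq [RHS]big_seq.
apply: eq_bigr => m /P_size le_m; rewrite deg1 hornerZ hornerXn mulrCA; congr (_ * _).
by rewrite expfB_cond ?(negbTE x0) // exprVn.
Qed.

(** F is linear, with matrix D.  Transversality at the fixed points makes the
    eigenvalues a_j simple; they are nonzero since F vanishes only at 0.  The
    determinant of 1 - J at the j-th eigenline is chi'(a_j) / a_j^n, where chi is
    the characteristic polynomial of D, so the sum is that of
    a_j^n P(1 / a_j) / chi'(a_j) for a polynomial P of degree at most n:
    interpolation evaluates it as P(0). *)
Lemma fixed_point_formula_1 : d = 1%N -> fixed_point_formula.
Proof.
move=> d1; pose D := jacobian_at F ((0 : 'rV[K]_n.+1) 0).
have jacD v : jacobian_at F (v 0) = D.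
  apply/matrixP => j k; rewrite !mxE.
  have := homog_mderiv k (F_homog j); rewrite d1 => /dhomog_msize_le/msize1_polyC ->.
  by rewrite !mevalC.
have eigenP lam v : eigen F lam v <-> D *m v^T = lam *: v^T.
  rewrite -(jacD v) (jacobian_at_euler F_homog) d1 scale1r.
  split=> [Fv|/colP Fv j]; last by have := Fv j; rewrite !mxE.
  by apply/colP => j; rewrite !mxE Fv.
have [r rE] := closed_field_poly_normal (char_poly D).
rewrite (monicP (char_poly_monic D)) scale1r in rE.
have r_size : size r = n.+1.
  by apply: succn_inj; rewrite -(size_prod_XsubC r id) -rE size_char_poly.
pose a (j : 'I_n.+1) := r`_j.
have chiE : char_poly D = \prod_j ('X - (a j)%:P).
  by rewrite rE (big_nth 0) big_mkord r_size.
have /choice [v vP] : forall j, exists v, v != 0 /\ eigen F (a j) v.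
  move=> j; have : (char_poly D).[a j] = 0.
    by rewrite chiE horner_prod (bigD1 j) //= hornerXsubC subrr mul0r.
  rewrite char_poly_horner -det_tr => /eqP/det0P[v v0 vD]; exists v; split=> //.
  apply/eigenP; apply/eqP; rewrite -subr_eq0 -mul_scalar_mx -mulmxBl -opprB mulNmx.
  by rewrite -[X in X *m _]trmxK -trmx_mul vD trmx0 oppr0.
have v0 j : v j != 0 by have [] := vP j.
have Fv j : eigen F (a j) (v j) by have [] := vP j.
have fv j : f (line_of (v j)) = line_of (v j) := eigen_fixed_line (v0 j) (Fv j).
have a0 j : a j != 0 := eigen_neq0 F_zero (v0 j) (Fv j).
(* the factor X - 1 of char_poly (a_j^-1 D) cancels on both sides *)
have weightE j : node_weight a j = a j ^+ n * \det (1%:M - Jac f (line_of (v j))).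
  have := char_poly_scale D (a0 j).
  have chiJ := char_poly_fixed F_homog F_zero F_f (fv j) (v0 j) (mem_line_of (v0 j)) (Fv j).
  rewrite -(jacD (v j)) chiJ.
  rewrite jacD chiE rmorph_prod (bigD1 j) //= d1.
  rewrite rmorphB /= comp_polyX comp_polyC -mul_polyC.
  rewrite -[X in _ - X]mulr1 -mulrBr -mul_polyC exprS rmorphM /= -!mulrA.
  move/(mulfI (_ : (a j)%:P != 0)); rewrite polyC_eq0 => /(_ (a0 j)).
  rewrite [RHS]mulrCA => /(mulfI (_ : 'X - 1 != 0)); rewrite polyXsubC_eq0 => /(_ isT).
  move/(congr1 (horner^~ 1)); rewrite hornerM hornerC char_poly_horner => <-.
  rewrite horner_prod; apply: eq_bigr => l _.
  by rewrite rmorphB /= comp_polyX comp_polyC !hornerE ?mulr1.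
have weight0 j : node_weight a j != 0.
  by rewrite weightE mulf_neq0 ?expf_neq0 ?f_simple.
have a_inj : injective a.
  move=> j k ajk; apply/eqP; rewrite eq_sym; apply: contraNT (weight0 j) => kj.
  by rewrite /node_weight (bigD1 k) //= ajk subrr mul0r.
exists [seq line_of (v j) | j <- enum 'I_n.+1].
  split=> [|p]; last split=> [/mapP[j _ ->] //|fp].
    rewrite map_inj_uniq ?enum_uniq // => j k vjk; apply: a_inj.
    have : v j \in val (line_of (v k)) by rewrite -vjk mem_line_of.
    case/(mem_line_ofP (v0 k)) => c vE; apply: (eigen_uniq (v0 j)) (Fv j) _.
    have d0 : (0 < d)%N by rewrite d1.
    by have := eigen_scale c d0 (Fv k); rewrite d1 expr0 mul1r -vE.
  have h0 := hcoord_neq0 p; have hp : hcoord p \in val p by apply: memv_pick.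
  have [lam Fh] := fixed_eigen F_f fp h0 hp.
  have [j aj] : exists j, lam = a j.
    have : (char_poly D).[lam] == 0.
      rewrite char_poly_horner -det_tr; apply/det0P; exists (hcoord p) => //.
      have /eigenP Dh := Fh.
      apply: trmx_inj; rewrite trmx_mul trmxK mulmxBl mul_scalar_mx Dh subrr.
      by rewrite trmx0.
    rewrite chiE horner_prod => /prodf_eq0[j _].
    by rewrite hornerXsubC subr_eq0 => /eqP; exists j.
  apply/mapP; exists j; first by rewrite mem_enum.
  apply/esym/line_of_eq; first exact: v0.
  apply: (fixed_eigenspace fp h0 hp Fh); rewrite jacD aj; exact/eigenP.
have [|P P_size PE] := @sigma_eval_mpoly 1 1 (\matrix_(j, k) (D j k *: 'X_ord0)).
  by move=> j k; rewrite mxE (leq_trans (msizeZ_le _ _)) // msizeX mdeg1.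
rewrite muln1 in P_size.
have {}PE x : P.@[fun=> x] = sigma_eval (x *: D).
  rewrite PE; congr sigma_eval; apply/matrixP => j k.
  by rewrite !mxE /= mevalZ mevalXU mulrC.
have [R [R_size Rn] RE] := homogenize_at_inv P_size.
rewrite -sigma_eval0 -(scale0r D) -PE -Rn.
rewrite -[n]/(n.+1.-1) -(lagrange_top_coef a_inj R_size) big_map big_enum.
apply: eq_bigr => j _; rewrite RE // PE weightE /index_term.
rewrite (mxpeval_Jac (fv j) (v0 j) (mem_line_of (v0 j)) (Fv j)) jacD.
by rewrite -mulf_div divff ?mul1r // expf_neq0.
Qed.

End FixedPointFormula.

Local Open Scope classical_set_scope.

Theorem mainTheorem1 (R : realType) (n d : nat)
    (B : {mpoly R[i][(n * n)%N]}) (Q : {mpoly R[i][n]})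
    (f : projspace R[i] n -> projspace R[i] n)
    (B_invariant : gl_invariant B)
    (B_degree : (msize B <= n.+1)%N)
    (B_sigma : forall A : 'M[R[i]]_n,
       mxpeval B A = Q.@[fun k : 'I_n => sigma k.+1 A])
    (f_degree : endo_of_degree d f)
    (f_transversal : graph_transversal f) :
  finite_set [set p | f p = p] /\
  \sum_(p \in [set p | f p = p]) mxpeval B (Jac f p) / \det (1%:M - Jac f p)
    = Q.@[fun k : 'I_n => (- d%:R) ^+ k.+1].
Proof.
have [F [F_homog F_zero F_f]] := f_degree.
have ucK := @uncountable_complex R.
have f_simple := (graph_transversalP f).1 f_transversal.
have Q_weight : (mweight Q <= n.+1)%N.
  by apply: leq_trans (sigma_weight ucK B_sigma) _; rewrite geq_max B_degree.
have [ps [ps_uniq psP] sum_ps] : fixed_point_formula d f B Q.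
  case: (ltngtP d 1) => [|d_gt1|d1].
  - by rewrite ltnS leqn0 => /eqP d0; apply: (fixed_point_formula_0 F_homog F_zero F_f).
  - exact: (fixed_point_formula_ge2 ucK F_homog F_zero F_f).
  - exact: (fixed_point_formula_1 F_homog F_zero F_f).
have fixE : [set p | f p = p] = [set` ps].
  by apply/seteqP; split=> p /psP.
split; first by apply/finite_seqP; exists ps.
by rewrite fixE -fsbig_seq.
Qed.
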